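(* Let $\mathcal{C}$ be a fusion category over $k$, where $k$ is an algebraically closed field of characteristic zero. If $k=\mathbb{C}$, then $|V|^2>0$ for all simple objects $V\in\mathcal{C}$; therefore $\dim(\mathcal{C})\ge 1$, and $\dim(\mathcal{C})>1$ for any nontrivial $\mathcal{C}$. In particular, for any fusion category $\mathcal{C}$ (over any algebraically closed field $k$ of characteristic zero) one has $\dim(\mathcal{C})\neq 0$.
   Context: A fusion category over $k$ is a $k$-linear semisimple rigid tensor (= monoidal) category with finitely many isomorphism classes of simple objects, finite dimensional spaces of morphisms, and $\operatorname{End}(\mathbf 1)=k$, where $\mathbf 1$ is the unit object. It is nontrivial if it has more than one simple object up to isomorphism. The dual of $V$ is denoted $V^*$, with $\mathrm{coev}_V:\mathbf 1\to V\otimes V^*$ and $\mathrm{ev}_V: V^*\otimes V\to \mathbf 1$. For a morphism $g:V\to V^{**}$ put $\mathrm{Tr}_V(g)=\mathrm{ev}_{V^*}\circ(g\otimes 1_{V^*})\circ \mathrm{coev}_V\in \operatorname{End}(\mathbf 1)=k$. In a fusion category every simple object $V$ is isomorphic to $V^{**}$. For a simple object $V$, choose an isomorphism $a:V\to V^{**}$; the squared norm of $V$ is $|V|^2=\mathrm{Tr}_V(a)\,\mathrm{Tr}_{V^*}((a^{-1})^* )\in k$ (it does not depend on $a$). The global dimension $\dim(\mathcal{C})$ is the sum of $|V|^2$ over the isomorphism classes of simple objects $V$ of $\mathcal{C}$. For $k=\mathbb{C}$, ''$|V|^2>0$'' means that $|V|^2$ is a positive real number. *)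

(* Defs.v *)
From mathcomp Require Import all_boot all_order all_algebra.
From mathcomp Require Import boolp classical_sets.

Set Implicit Arguments.
Unset Strict Implicit.
Unset Printing Implicit Defensive.

Import GRing.Theory.
Local Open Scope ring_scope.

Declare Scope cat_scope.
Delimit Scope cat_scope with cat.
Reserved Notation "g \oc f" (at level 50, left associativity).
Reserved Notation "X \ox Y" (at level 40, left associativity).
Reserved Notation "f \om g" (at level 40, left associativity).

(* Hom spaces are finite dimensional because they are of type [vectType k]. *)
Record linCategory (k : fieldType) := LinCategory {
  obj :> Type;
  hom : obj -> obj -> vectType k;
  idm : forall X : obj, hom X X;
  comp : forall X Y Z : obj, hom Y Z -> hom X Y -> hom X Z;
  compA : forall (W X Y Z : obj) (h : hom Y Z) (g : hom X Y) (f : hom W X),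
    comp h (comp g f) = comp (comp h g) f;
  comp1m : forall (X Y : obj) (f : hom X Y), comp (idm Y) f = f;
  compm1 : forall (X Y : obj) (f : hom X Y), comp f (idm X) = f;
  comp_linearr : forall (X Y Z : obj) (g : hom Y Z),
    linear (fun f : hom X Y => comp g f);
  comp_linearl : forall (X Y Z : obj) (f : hom X Y),
    linear (fun g : hom Y Z => comp g f)
}.

Arguments hom {k l} _ _.
Arguments idm {k l} X.
Arguments comp {k l X Y Z} _ _.
Notation "g \oc f" := (comp g f) : cat_scope.
Local Open Scope cat_scope.

Section LinearCategories.
Variables (k : fieldType) (C : linCategory k).
Implicit Types X Y Z W V K : C.

Definition is_inverse X Y (f : hom X Y) (g : hom Y X) : Prop :=
  g \oc f = idm X /\ f \oc g = idm Y.

Definition is_iso X Y (f : hom X Y) : Prop := exists g, is_inverse f g.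

Definition isomorphic X Y : Prop := exists f : hom X Y, is_iso f.

Definition is_mono X Y (f : hom X Y) : Prop :=
  forall W (g h : hom W X), f \oc g = f \oc h -> g = h.

Definition is_epi X Y (f : hom X Y) : Prop :=
  forall Z (g h : hom Y Z), g \oc f = h \oc f -> g = h.

(* Hom spaces contain 0, so this says that X is both initial and terminal. *)
Definition is_zero_obj X : Prop :=
  (forall Y (f : hom X Y), f = 0) /\ (forall Y (f : hom Y X), f = 0).

Definition is_kernel X Y (f : hom X Y) K (i : hom K X) : Prop :=
  f \oc i = 0 /\
  forall W (g : hom W X), f \oc g = 0 -> exists! u : hom W K, i \oc u = g.

Definition is_cokernel X Y (f : hom X Y) K (p : hom Y K) : Prop :=
  p \oc f = 0 /\
  forall Z (g : hom Y Z), g \oc f = 0 -> exists! u : hom K Z, u \oc p = g.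

(* Finite biproduct; for n = 0 it says that X is a zero object. *)
Definition is_direct_sum n (S : 'I_n -> C) X : Prop :=
  exists (i : forall j, hom (S j) X) (p : forall j, hom X (S j)),
    [/\ forall j, p j \oc i j = idm (S j),
        forall j l, j != l -> p l \oc i j = 0
      & \sum_(j < n) (i j \oc p j) = idm X].

Definition is_abelian : Prop :=
  [/\ forall n (S : 'I_n -> C), exists X, is_direct_sum S X,
      forall X Y (f : hom X Y), exists K (i : hom K X), is_kernel f i,
      forall X Y (f : hom X Y), exists K (p : hom Y K), is_cokernel f p,
      forall X Y (f : hom X Y), is_mono f ->
        exists Z (g : hom Y Z), is_kernel g f
    & forall X Y (f : hom X Y), is_epi f ->
        exists W (g : hom W X), is_cokernel g f].

Definition is_simple V : Prop :=
  ~ is_zero_obj V /\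
  forall W (i : hom W V), is_mono i -> is_zero_obj W \/ is_iso i.

Definition is_semisimple : Prop :=
  is_abelian /\
  forall X, exists n (S : 'I_n -> C),
    (forall j, is_simple (S j)) /\ is_direct_sum S X.

Definition is_simple_transversal n (S : 'I_n -> C) : Prop :=
  [/\ forall j, is_simple (S j),
      forall V, is_simple V -> exists j, isomorphic V (S j)
    & forall j l, isomorphic (S j) (S l) -> j = l].

Definition is_nontrivial : Prop :=
  exists V W, [/\ is_simple V, is_simple W & ~ isomorphic V W].

End LinearCategories.

Record tensorCategory (k : fieldType) := TensorCategory {
  tensor_lin :> linCategory k;
  unit_obj : tensor_lin;
  tens : tensor_lin -> tensor_lin -> tensor_lin;
  tensm : forall X X' Y Y' : tensor_lin,
    hom X X' -> hom Y Y' -> hom (tens X Y) (tens X' Y');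
  assoc : forall X Y Z, hom (tens (tens X Y) Z) (tens X (tens Y Z));
  assocV : forall X Y Z, hom (tens X (tens Y Z)) (tens (tens X Y) Z);
  lunit : forall X, hom (tens unit_obj X) X;
  lunitV : forall X, hom X (tens unit_obj X);
  runit : forall X, hom (tens X unit_obj) X;
  runitV : forall X, hom X (tens X unit_obj);
  tensm1 : forall X Y, tensm (idm X) (idm Y) = idm (tens X Y);
  tensm_comp : forall (X X' X'' Y Y' Y'' : tensor_lin)
      (f' : hom X' X'') (f : hom X X') (g' : hom Y' Y'') (g : hom Y Y'),
    tensm (f' \oc f) (g' \oc g) = tensm f' g' \oc tensm f g;
  tensm_linearr : forall (X X' Y Y' : tensor_lin) (f : hom X X'),
    linear (fun g : hom Y Y' => tensm f g);
  tensm_linearl : forall (X X' Y Y' : tensor_lin) (g : hom Y Y'),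
    linear (fun f : hom X X' => tensm f g);
  assocK : forall X Y Z, is_inverse (assoc X Y Z) (assocV X Y Z);
  lunitK : forall X, is_inverse (lunit X) (lunitV X);
  runitK : forall X, is_inverse (runit X) (runitV X);
  assoc_nat : forall (X X' Y Y' Z Z' : tensor_lin)
      (f : hom X X') (g : hom Y Y') (h : hom Z Z'),
    assoc X' Y' Z' \oc tensm (tensm f g) h
    = tensm f (tensm g h) \oc assoc X Y Z;
  lunit_nat : forall (X Y : tensor_lin) (f : hom X Y),
    lunit Y \oc tensm (idm unit_obj) f = f \oc lunit X;
  runit_nat : forall (X Y : tensor_lin) (f : hom X Y),
    runit Y \oc tensm f (idm unit_obj) = f \oc runit X;
  pentagon : forall W X Y Z,
    assoc W X (tens Y Z) \oc assoc (tens W X) Y Z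
    = tensm (idm W) (assoc X Y Z) \oc assoc W (tens X Y) Z
      \oc tensm (assoc W X Y) (idm Z);
  triangle : forall X Y,
    tensm (idm X) (lunit Y) \oc assoc X unit_obj Y
    = tensm (runit X) (idm Y)
}.

Arguments unit_obj {k t}.
Arguments tens {k t} _ _.
Arguments tensm {k t X X' Y Y'} _ _.
Arguments assoc {k t} X Y Z.
Arguments assocV {k t} X Y Z.
Arguments lunit {k t} X.
Arguments lunitV {k t} X.
Arguments runit {k t} X.
Arguments runitV {k t} X.
Notation "X \ox Y" := (tens X Y) : cat_scope.
Notation "f \om g" := (tensm f g) : cat_scope.

Definition is_dual (k : fieldType) (C : tensorCategory k) (V D : C)
    (ev : hom (D \ox V) unit_obj) (coev : hom unit_obj (V \ox D)) : Prop :=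
  runit V \oc (idm V \om ev) \oc assoc V D V \oc (coev \om idm V) \oc lunitV V
    = idm V /\
  lunit D \oc (ev \om idm D) \oc assocV D V D \oc (idm D \om coev) \oc runitV D
    = idm D.

(* [dual], [ev], [coev] fix a choice of V^*; duals on the other side are only
   required to exist ([has_predual]: V is a dual of some D). *)
Record fusionCategory (k : fieldType) := FusionCategory {
  fusion_tensor :> tensorCategory k;
  dual : fusion_tensor -> fusion_tensor;
  ev : forall V : fusion_tensor, hom (dual V \ox V) unit_obj;
  coev : forall V : fusion_tensor, hom unit_obj (V \ox dual V);
  dualP : forall V : fusion_tensor, is_dual (ev V) (coev V);
  has_predual : forall V : fusion_tensor,
    exists (D : fusion_tensor) (e : hom (V \ox D) unit_obj)
      (c : hom unit_obj (D \ox V)), is_dual e c;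
  semisimpleP : is_semisimple fusion_tensor;
  finite_simples : exists S : {n : nat & 'I_n -> fusion_tensor},
    is_simple_transversal (tagged S);
  end_unit :
    bijective (fun c : k => c *: idm (unit_obj : fusion_tensor))
}.

Arguments dual {k f} V.
Arguments ev {k f} V.
Arguments coev {k f} V.

Section GlobalDimension.
Variables (k : fieldType) (C : fusionCategory k).
Implicit Types X Y V : C.

Definition dualm X Y (f : hom X Y) : hom (dual Y) (dual X) :=
  lunit (dual X) \oc (ev Y \om idm (dual X)) \oc assocV (dual Y) Y (dual X)
  \oc (idm (dual Y) \om (f \om idm (dual X)))
  \oc (idm (dual Y) \om coev X) \oc runitV (dual Y).

(* The identification End(1) = k: coordinate in the basis (id_1). *)
Definition scalar_of (f : hom (unit_obj : C) unit_obj) : k :=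
  coord [tuple idm (unit_obj : C)] ord0 f.

Lemma scalar_ofE (f : hom (unit_obj : C) unit_obj) :
  scalar_of f *: idm (unit_obj : C) = f.
Proof.
have [g _ gK] := end_unit C.
have f_span : f \in <<[tuple idm (unit_obj : C)]>>%VS.
  by rewrite span_seq1; apply/vlineP; exists (g f); rewrite gK.
by rewrite {2}(coord_span f_span) big_ord1.
Qed.

Definition trace V (g : hom V (dual (dual V))) : k :=
  scalar_of (ev (dual V) \oc (g \om idm (dual V)) \oc coev V).

(* The value does not depend on the isomorphism a : V -> V^** with inverse b;
   the default 0 would only be used if there were none. *)
Definition sqnorm V : k :=
  xget 0 [set x | exists (a : hom V (dual (dual V))) (b : hom (dual (dual V)) V),
    is_inverse a b /\ x = trace a * trace (dualm b)]%classic.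

Definition simples : {n : nat & 'I_n -> C} := projT1 (cid (finite_simples C)).

Definition global_dim : k := \sum_(j < tag simples) sqnorm (tagged simples j).

End GlobalDimension.

Arguments global_dim {k} C.

(* Main.v *)
From HB Require Import structures.
From mathcomp Require Import all_boot all_order all_algebra.
From mathcomp Require Import boolp classical_sets reals complex.
Require Import Defs.

(** Write d_X for a quantum dimension: for a simple object X an isomorphism
    a : X -> X^** turns X^* into a left and a right dual of X, and closing X on
    the right, respectively on the left, gives the scalars Tr(a) and
    Tr((a^-1)^* ).  Their product is |X|^2, and rescaling a by a square root of
    their ratio makes them equal to one scalar d_X with d_X^2 = |X|^2
    ([normalized_pivot]).

    The heart of the proof is a replacement for Radford's formula.  Let a, b, c
    be simple and f : c -> a (x) b, g : a (x) b -> c.  Bending the legs of f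
    around, with the duals of c on the one side and those of a and b on the
    other, gives a new morphism [twist] f : c -> a (x) b (the double dual of f
    transported along the isomorphisms x -> x^** ).  Sliding morphisms around a
    closed diagram shows that the right closure of (twist f) g is that of g f,
    and that the left closure of f g is that of g (twist f).  But the left and
    the right closure of an endomorphism of a (x) b are proportional, with
    ratio 1 for normalised dimensions: both are computed by closing a on the
    left and b on the right, in either order ([ltrace_rtrace]).  Hence twist is
    an involution of Hom(c, a (x) b), and its trace T_ab^c is an integer
    ([pivotal_exchange], [theta_cube], [trace_tripotent]).

    Taking traces of identity morphisms of a (x) b and a^* (x) c then yields
      sum_c T_ab^c d_c = d_a d_b   and   sum_b T_ab^c d_b = d_a d_c,
    so the vector d is a common eigenvector of the integer matrices T_a and
    their transposes, with eigenvalue d_a.  Therefore: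
    - over the complex numbers, pairing T_a d with its conjugate in two ways
      gives |d_a|^2 |d|^2 = d_a^2 |d|^2, so that d_a^2 is positive;
    - over any field of characteristic 0, d is an eigenvector of the integer
      matrix N = sum_a T_a^T T_a with eigenvalue the global dimension.  For
      a isomorphic to the unit T_a is a nonzero integer multiple of the
      identity, so N is positive definite, its determinant is a nonzero
      integer, and the global dimension does not vanish.

    Associativity constraints are avoided by letting X act as the endofunctor
    X (x) - of C.  Diagrams are drawn with natural transformations between
    composites of such functors; those which commute with the right action of
    C on itself ([is_mnat]) between X (x) - and Y (x) - are exactly the
    morphisms X -> Y ([lift_desc]). *)

Set Implicit Arguments.
Unset Strict Implicit.
Unset Printing Implicit Defensive.

Import GRing.Theory.
Local Open Scope ring_scope.
Local Open Scope cat_scope.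

(** * Linear and monoidal preliminaries *)

Section Linear.
Variables (k : fieldType) (C : linCategory k).
Implicit Types X Y Z W : C.

(** Rewriting by an equation between composites inside a longer composite that
    is bracketed to the right. *)
Lemma comp_precomp X Y Z (g : hom Y Z) (f : hom X Y) (h : hom X Z) :
  g \oc f = h -> forall W (r : hom W X), g \oc (f \oc r) = h \oc r.
Proof. by move=> <- W r; rewrite compA. Qed.

Lemma comp_precomp2 X X' Y Z (g : hom Y Z) (f : hom X' Y) (e : hom X X')
    (h : hom X Z) :
  g \oc (f \oc e) = h ->
  forall W (r : hom W X), g \oc (f \oc (e \oc r)) = h \oc r.
Proof. by move=> <- W r; rewrite !compA. Qed.

Lemma compDr X Y Z (g : hom Y Z) (f1 f2 : hom X Y) :
  g \oc (f1 + f2) = (g \oc f1) + (g \oc f2).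
Proof. by have := comp_linearr g 1 f1 f2; rewrite !scale1r. Qed.

Lemma compDl X Y Z (g1 g2 : hom Y Z) (f : hom X Y) :
  (g1 + g2) \oc f = (g1 \oc f) + (g2 \oc f).
Proof. by have := comp_linearl f 1 g1 g2; rewrite !scale1r. Qed.

Lemma compr0 X Y Z (g : hom Y Z) : g \oc (0 : hom X Y) = 0.
Proof. by apply: (addrI (g \oc 0)); rewrite -compDr !addr0. Qed.

Lemma comp0r X Y Z (f : hom X Y) : (0 : hom Y Z) \oc f = 0.
Proof. by apply: (addrI (0 \oc f)); rewrite -compDl !addr0. Qed.

Lemma compZr c X Y Z (g : hom Y Z) (f : hom X Y) :
  g \oc (c *: f) = c *: (g \oc f).
Proof. by have := comp_linearr g c f 0; rewrite compr0 !addr0. Qed.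

Lemma compZl c X Y Z (g : hom Y Z) (f : hom X Y) :
  (c *: g) \oc f = c *: (g \oc f).
Proof. by have := comp_linearl f c g 0; rewrite comp0r !addr0. Qed.

Lemma compNr X Y Z (g : hom Y Z) (f : hom X Y) : g \oc (- f) = - (g \oc f).
Proof. by rewrite -scaleN1r compZr scaleN1r. Qed.

Lemma compNl X Y Z (g : hom Y Z) (f : hom X Y) : (- g) \oc f = - (g \oc f).
Proof. by rewrite -scaleN1r compZl scaleN1r. Qed.

Lemma comp_sumr I (r : seq I) (P : pred I) X Y Z (g : hom Y Z)
    (F : I -> hom X Y) :
  g \oc (\sum_(i <- r | P i) F i) = \sum_(i <- r | P i) (g \oc F i).
Proof. by elim/big_rec2: _ => [|i y z _ <-]; rewrite ?compr0 ?compDr. Qed.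

Lemma comp_suml I (r : seq I) (P : pred I) X Y Z (f : hom X Y)
    (F : I -> hom Y Z) :
  (\sum_(i <- r | P i) F i) \oc f = \sum_(i <- r | P i) (F i \oc f).
Proof. by elim/big_rec2: _ => [|i y z _ <-]; rewrite ?comp0r ?compDl. Qed.

Lemma iso_cancell X Y Z (g : hom Y Z) (g' : hom Z Y) (f1 f2 : hom X Y) :
  is_inverse g g' -> g \oc f1 = g \oc f2 -> f1 = f2.
Proof. by case=> gK _ e; rewrite -(comp1m f1) -(comp1m f2) -gK -!compA e. Qed.

Lemma iso_cancelr X Y Z (f : hom X Y) (f' : hom Y X) (g1 g2 : hom Y Z) :
  is_inverse f f' -> g1 \oc f = g2 \oc f -> g1 = g2.
Proof. by case=> _ fK e; rewrite -(compm1 g1) -(compm1 g2) -fK !compA e. Qed.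

Lemma is_inverse_sym X Y (f : hom X Y) (g : hom Y X) :
  is_inverse f g -> is_inverse g f.
Proof. by case. Qed.

End Linear.

Section Coherence.
Variables (k : fieldType) (C : tensorCategory k).
Implicit Types X Y Z W : C.
Local Notation I1 := (unit_obj : C).

Lemma tensm0r X X' Y Y' (f : hom X X') :
  f \om (0 : hom Y Y') = 0 :> hom (X \ox Y : C) _.
Proof.
apply: (addrI (f \om 0)); have := tensm_linearr f 1 (0 : hom Y Y') 0.
by rewrite !scale1r !addr0 => {1}<-.
Qed.

Lemma tensm0l X X' Y Y' (g : hom Y Y') :
  (0 : hom X X') \om g = 0 :> hom (X \ox Y : C) _.
Proof.
apply: (addrI (0 \om g)); have := tensm_linearl g 1 (0 : hom X X') 0.
by rewrite !scale1r !addr0 => {1}<-.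
Qed.

Lemma tensmZl c X X' Y Y' (f : hom X X') (g : hom Y Y') :
  (c *: f) \om g = c *: (f \om g) :> hom (X \ox Y : C) _.
Proof. by have := tensm_linearl g c f 0; rewrite tensm0l !addr0. Qed.

Lemma tensm_split X X' Y Y' (f : hom X X') (g : hom Y Y') :
  f \om g = (f \om idm Y') \oc (idm X \om g) :> hom (X \ox Y : C) _.
Proof. by rewrite -tensm_comp compm1 comp1m. Qed.

Lemma tensm_split' X X' Y Y' (f : hom X X') (g : hom Y Y') :
  f \om g = (idm X' \om g) \oc (f \om idm Y) :> hom (X \ox Y : C) _.
Proof. by rewrite -tensm_comp compm1 comp1m. Qed.

Lemma tensm_compl X X' X'' W (f : hom X' X'') (g : hom X X') :
  (f \oc g) \om idm W = (f \om idm W) \oc (g \om idm W) :> hom (X \ox W : C) _.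
Proof. by rewrite -tensm_comp comp1m. Qed.

Lemma tensm_compr X X' X'' W (f : hom X' X'') (g : hom X X') :
  idm W \om (f \oc g) = (idm W \om f) \oc (idm W \om g) :> hom (W \ox X : C) _.
Proof. by rewrite -tensm_comp comp1m. Qed.

Lemma tensm_exch X X' Y Y' (f : hom X X') (g : hom Y Y') :
  (f \om idm Y') \oc (idm X \om g) = (idm X' \om g) \oc (f \om idm Y)
    :> hom (X \ox Y : C) _.
Proof. by rewrite -tensm_split tensm_split'. Qed.

Lemma assocVK X Y Z : assocV X Y Z \oc assoc X Y Z = idm (X \ox Y \ox Z : C).
Proof. by case: (assocK X Y Z). Qed.
Lemma assocKV X Y Z : assoc X Y Z \oc assocV X Y Z = idm (X \ox (Y \ox Z) : C).
Proof. by case: (assocK X Y Z). Qed.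
Lemma lunitKV X : lunit X \oc lunitV X = idm (X : C).
Proof. by case: (lunitK X). Qed.
Lemma runitKV X : runit X \oc runitV X = idm (X : C).
Proof. by case: (runitK X). Qed.

Lemma assocV_nat X X' Y Y' Z Z' (f : hom X X') (g : hom Y Y') (h : hom Z Z') :
  assocV X' Y' Z' \oc (f \om (g \om h))
    = f \om g \om h \oc assocV X Y Z :> hom (X \ox (Y \ox Z) : C) _.
Proof.
apply: (iso_cancelr (assocK X Y Z)); rewrite -!compA -assoc_nat assocVK compm1.
by rewrite compA assocVK comp1m.
Qed.

Lemma tens1_faithful X Y (f g : hom X Y) :
  idm I1 \om f = idm I1 \om g -> f = g.
Proof.
move=> e; apply: (iso_cancelr (lunitK X)).
by rewrite -!lunit_nat e.
Qed.

Lemma tens_faithful1 X Y (f g : hom X Y) :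
  f \om idm I1 = g \om idm I1 -> f = g.
Proof.
move=> e; apply: (iso_cancelr (runitK X)).
by rewrite -!runit_nat e.
Qed.

Lemma tensm_inverse X X' Y Y' (f : hom X X') f' (g : hom Y Y') g' :
  is_inverse f f' -> is_inverse g g' ->
  is_inverse (f \om g : hom (X \ox Y : C) _) (f' \om g').
Proof. by case=> a b [c d]; split; rewrite -tensm_comp ?a ?b ?c ?d tensm1. Qed.

Lemma is_inverse1 X : is_inverse (idm X) (idm X).
Proof. by split; rewrite comp1m. Qed.

(** Kelly's coherences between the unit constraints and tensor products.  Both
    come from the pentagon with a unit object in it; tensoring with the unit on
    the outside is faithful, so it is enough to prove them after doing so. *)
Lemma lunit_tens X Y :
  lunit (X \ox Y) \oc assoc I1 X Y = lunit X \om idm Y.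
Proof.
apply: tens1_faithful.
apply: (iso_cancelr (assocK I1 (I1 \ox X) Y)).
apply: (iso_cancelr (tensm_inverse (assocK I1 I1 X) (is_inverse1 Y))).
rewrite -assoc_nat tensm_compr -!compA.
rewrite -tensm_compl triangle.
have P := pentagon I1 I1 X Y; rewrite -compA in P.
by rewrite -P compA triangle assoc_nat tensm1.
Qed.

Lemma runit_tens X Y :
  (idm X \om runit Y) \oc assoc X Y I1 = runit (X \ox Y).
Proof.
apply: tens_faithful1.
rewrite tensm_compl.
apply: (iso_cancell (assocK X Y I1)).
rewrite compA assoc_nat -(triangle Y I1) tensm_compr -!compA.
have P := pentagon X Y I1 I1; rewrite -!compA in P.
by rewrite -P -triangle !compA -tensm1 assoc_nat.
Qed.

Lemma lunit1 : lunit I1 = runit I1.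
Proof.
apply: tens_faithful1; rewrite -triangle -lunit_tens; congr (_ \oc _).
apply: (iso_cancell (lunitK I1)).
by rewrite lunit_nat.
Qed.

End Coherence.

(** * Endofunctors commuting with the right action *)

Section Functors.
Variables (k : fieldType) (C : tensorCategory k).
Implicit Types X Y Z W T : C.
Local Notation I1 := (unit_obj : C).

(** An endofunctor F with its compatibility with the right action of C.  The
    component F Z (x) W -> F (Z (x) W) of that compatibility is encoded by the
    operation [fstr] which composes it with the image under F of a morphism out
    of Z (x) W.  In this form the compatibility of a composite functor is a
    composite of operations; hence, the laws being kept apart and the
    projections primitive, composition of endofunctors is associative and
    unital by conversion. *)
#[projections(primitive)] Record endo := Endo {
  fobj :> C -> C;
  fmap : forall X Y, hom X Y -> hom (fobj X) (fobj Y);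
  fstr : forall Z W T, hom (Z \ox W) T -> hom (fobj Z \ox W) (fobj T)
}.

Implicit Types F G H : endo.

Record lawful (F : endo) : Prop := Lawful {
  fmap1 : forall X, fmap F (idm X) = idm (F X);
  fmapM : forall X Y Z (g : hom Y Z) (f : hom X Y),
    fmap F (g \oc f) = fmap F g \oc fmap F f;
  fmap_linear : forall X Y, linear (@fmap F X Y);
  fstr_natl : forall Z Z' W T (u : hom (Z' \ox W) T) (f : hom Z Z'),
    fstr F (u \oc (f \om idm W)) = fstr F u \oc (fmap F f \om idm W);
  fstr_natr : forall Z W T T' (v : hom T T') (u : hom (Z \ox W) T),
    fstr F (v \oc u) = fmap F v \oc fstr F u
}.

Definition fid : endo :=
  @Endo (fun X => X) (fun X Y f => f) (fun Z W T u => u).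

Definition fcomp (F G : endo) : endo :=
  @Endo (fun X => F (G X)) (fun X Y f => fmap F (fmap G f))
    (fun Z W T u => fstr F (fstr G u)).

Definition ltens X : endo :=
  @Endo (fun Z => X \ox Z) (fun Z Z' f => idm X \om f)
    (fun Z W T u => (idm X \om u) \oc assoc X Z W).

Lemma lawful_id : lawful fid.
Proof. by split. Qed.

Lemma lawful_comp F G : lawful F -> lawful G -> lawful (fcomp F G).
Proof.
move=> [a1 a2 a3 a4 a5] [b1 b2 b3 b4 b5]; split=> /=.
- by move=> X; rewrite b1 a1.
- by move=> X Y Z g f; rewrite b2 a2.
- by move=> X Y c f g; rewrite b3 a3.
- by move=> *; rewrite b4 a4.
- by move=> *; rewrite b5 a5.
Qed.

Lemma lawful_tens X : lawful (ltens X).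
Proof.
split=> /=.
- by move=> Z; rewrite tensm1.
- by move=> *; rewrite tensm_compr.
- by move=> Y Z c f g; rewrite tensm_linearr.
- by move=> Z Z' W T u f; rewrite tensm_compr -!compA assoc_nat.
- by move=> *; rewrite tensm_compr -!compA.
Qed.

Lemma fmap0 F X Y : lawful F -> fmap F (0 : hom X Y) = 0.
Proof.
move=> LF; apply: (addrI (fmap F 0)); have := fmap_linear LF 1 (0 : hom X Y) 0.
by rewrite !scale1r !addr0 => {1}<-.
Qed.

Lemma fmapZ F X Y c (f : hom X Y) : lawful F -> fmap F (c *: f) = c *: fmap F f.
Proof. by move=> LF; have := fmap_linear LF c f 0; rewrite fmap0 // !addr0. Qed.

Lemma fmapD F X Y (f g : hom X Y) : lawful F ->
  fmap F (f + g) = fmap F f + fmap F g.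
Proof. by move=> LF; have := fmap_linear LF 1 f g; rewrite !scale1r. Qed.

Lemma fmap_sum F X Y I (r : seq I) (P : pred I) (f : I -> hom X Y) : lawful F ->
  fmap F (\sum_(i <- r | P i) f i) = \sum_(i <- r | P i) fmap F (f i).
Proof. by move=> LF; elim/big_rec2: _ => [|i y z _ <-]; rewrite ?fmap0 ?fmapD. Qed.

Definition fam (F G : endo) := forall Z, hom (F Z) (G Z).

(** Natural transformations of right module functors. *)
Record is_mnat (F G : endo) (al : fam F G) : Prop := IsMnat {
  mnat_natural : forall X Y (f : hom X Y), al Y \oc fmap F f = fmap G f \oc al X;
  mnat_module : forall Z W T (u : hom (Z \ox W) T),
    al T \oc fstr F u = fstr G u \oc (al Z \om idm W)
}.

Lemma mnat_comp F G H (be : fam G H) (al : fam F G) :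
  is_mnat be -> is_mnat al ->
  is_mnat (F := F) (G := H) (fun Z => be Z \oc al Z).
Proof.
move=> [n1 m1] [n2 m2]; split=> [X Y f|Z W T u].
  by rewrite -compA n2 !compA n1.
by rewrite -compA m2 compA m1 -compA -tensm_compl.
Qed.

Lemma mnat_whiskr H F G (al : fam F G) :
  is_mnat al -> is_mnat (F := fcomp F H) (G := fcomp G H) (fun Z => al (H Z)).
Proof. by move=> [n m]; split=> * /=; rewrite ?n ?m. Qed.

Lemma mnat_whiskl H F G (al : fam F G) : lawful H ->
  is_mnat al ->
  is_mnat (F := fcomp H F) (G := fcomp H G) (fun Z => fmap H (al Z)).
Proof.
move=> LH [n m]; split=> * /=; first by rewrite -!(fmapM LH) n.
by rewrite -(fstr_natr LH) m (fstr_natl LH).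
Qed.

(** In a natural family the module condition follows from its instance at an
    identity morphism, the usual square for the constraints. *)
Lemma is_mnat_natural F G (al : fam F G) : lawful F -> lawful G ->
  (forall X Y (f : hom X Y), al Y \oc fmap F f = fmap G f \oc al X) ->
  (forall Z W, al (Z \ox W) \oc fstr F (idm _)
     = fstr G (idm _) \oc (al Z \om idm W)) ->
  is_mnat al.
Proof.
move=> LF LG n m; split=> // Z W T u.
rewrite -{1}(compm1 u) (fstr_natr LF) compA n -compA m compA.
by rewrite -(fstr_natr LG) compm1.
Qed.

Definition lift X Y (f : hom X Y) : fam (ltens X) (ltens Y) :=
  fun Z => f \om idm Z.

Definition desc X Y (al : fam (ltens X) (ltens Y)) : hom X Y :=
  runit Y \oc al I1 \oc runitV X.

Lemma lift_mnat X Y (f : hom X Y) : is_mnat (lift f).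
Proof.
split=> [Z W g|Z W T u] /=; first exact: tensm_exch.
by rewrite /lift compA tensm_exch -!compA assoc_nat tensm1.
Qed.

(** A module transformation is determined by its component at the unit object,
    because Z is isomorphic to the tensor product of the unit with Z.  Thus
    X |-> X (x) - is fully faithful into module functors. *)
Lemma lift_desc X Y (al : fam (ltens X) (ltens Y)) :
  is_mnat al -> forall Z, al Z = lift (desc al) Z.
Proof.
move=> [n m] Z; rewrite /lift /desc !tensm_compl.
have e := m I1 Z Z (lunit Z); rewrite /= !triangle in e.
by rewrite -e -compA -tensm_compl runitKV tensm1 compm1.
Qed.

Definition assocf X Y : fam (ltens (X \ox Y)) (fcomp (ltens X) (ltens Y)) :=
  fun Z => assoc X Y Z.
Definition assocVf X Y : fam (fcomp (ltens X) (ltens Y)) (ltens (X \ox Y)) :=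
  fun Z => assocV X Y Z.

Lemma assocf_mnat X Y : is_mnat (@assocf X Y).
Proof.
apply: is_mnat_natural => [||Z W f|Z W] /=.
- exact: lawful_tens.
- by apply: lawful_comp; exact: lawful_tens.
- by rewrite -assoc_nat tensm1.
by rewrite !tensm1 !comp1m pentagon.
Qed.

Lemma mnat_inv F G (al : fam F G) (be : fam G F) :
  (forall Z, is_inverse (al Z) (be Z)) -> is_mnat al -> is_mnat be.
Proof.
move=> K [n m]; split=> [X Y f|Z W T u].
  apply: (iso_cancelr (K X)); rewrite -!compA -n.
  by case: (K X) => -> _; case: (K Y) => e _; rewrite compA e comp1m compm1.
apply: (iso_cancelr (tensm_inverse (K Z) (is_inverse1 W))).
rewrite -!compA -m -tensm_compl.
case: (K Z) => -> _; rewrite tensm1 compm1.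
by case: (K T) => e _; rewrite compA e comp1m.
Qed.

Lemma assocVf_mnat X Y : is_mnat (@assocVf X Y).
Proof. by apply: (mnat_inv _ (@assocf_mnat X Y)) => Z; exact: assocK. Qed.

Definition lunitf : fam (ltens I1) fid := fun Z => lunit Z.
Definition lunitVf : fam fid (ltens I1) := fun Z => lunitV Z.

Lemma lunitf_mnat : is_mnat lunitf.
Proof.
apply: is_mnat_natural => [||Z W f|Z W] /=.
- exact: lawful_tens.
- exact: lawful_id.
- exact: lunit_nat.
by rewrite tensm1 !comp1m lunit_tens.
Qed.

Lemma lunitVf_mnat : is_mnat lunitVf.
Proof. by apply: (mnat_inv _ lunitf_mnat) => Z; exact: lunitK. Qed.

(** G is left adjoint to F. *)
Record adj (F G : endo) := Adj {
  aunit : fam fid (fcomp F G);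
  acounit : fam (fcomp G F) fid;
  aunit_mnat : is_mnat aunit;
  acounit_mnat : is_mnat acounit;
  zigzag1 : forall Z, fmap F (acounit Z) \oc aunit (F Z) = idm (F Z);
  zigzag2 : forall Z, acounit (G Z) \oc fmap G (aunit Z) = idm (G Z)
}.

(** The bijection between morphisms G X -> Z and X -> F Z, in both directions. *)
Lemma adjunct_counit F G (p : adj F G) (LG : lawful G) X Z (r : hom (G X) Z) :
  r = acounit p Z \oc fmap G (fmap F r \oc aunit p X).
Proof.
rewrite fmapM // compA; have /= -> := mnat_natural (acounit_mnat p) r.
by rewrite -compA zigzag2 compm1.
Qed.

Lemma adjunct_unit F G (p : adj F G) (LF : lawful F) X Z (s : hom X (F Z)) :
  s = fmap F (acounit p Z \oc fmap G s) \oc aunit p X.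
Proof.
rewrite fmapM // -compA; have /= <- := mnat_natural (aunit_mnat p) s.
by rewrite compA zigzag1 comp1m.
Qed.

Section CompAdj.
Variables (F G F' G' : endo).
Hypotheses (LF : lawful F) (LG : lawful G) (LF' : lawful F') (LG' : lawful G').
Variables (p : adj F G) (q : adj F' G').

Definition comp_unit : fam fid (fcomp (fcomp F F') (fcomp G' G)) :=
  fun Z => fmap F (aunit q (G Z)) \oc aunit p Z.
Definition comp_counit : fam (fcomp (fcomp G' G) (fcomp F F')) fid :=
  fun Z => acounit q Z \oc fmap G' (acounit p (F' Z)).

Lemma comp_unit_mnat : is_mnat comp_unit.
Proof.
rewrite /comp_unit; have a := aunit_mnat p; have b := aunit_mnat q.
exact: mnat_comp (mnat_whiskl LF (mnat_whiskr G b)) a.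
Qed.

Lemma comp_counit_mnat : is_mnat comp_counit.
Proof.
rewrite /comp_counit; have a := acounit_mnat p; have b := acounit_mnat q.
exact: mnat_comp b (mnat_whiskl LG' (mnat_whiskr F' a)).
Qed.

Lemma comp_zigzag1 Z :
  fmap (fcomp F F') (comp_counit Z) \oc comp_unit (F (F' Z)) = idm (F (F' Z)).
Proof.
rewrite /comp_unit /comp_counit /= (fmapM LF') (fmapM LF) -!compA.
have e := mnat_natural (aunit_mnat q) (acounit p (F' Z)); rewrite /= in e.
rewrite (comp_precomp (esym (fmapM LF _ (aunit q (G (F (F' Z))))))) -e (fmapM LF).
rewrite -compA (zigzag1 p (F' Z)).
by rewrite compm1 -(fmapM LF) (zigzag1 q) (fmap1 LF).
Qed.

Lemma comp_zigzag2 Z :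
  comp_counit (G' (G Z)) \oc fmap (fcomp G' G) (comp_unit Z) = idm (G' (G Z)).
Proof.
rewrite /comp_unit /comp_counit /= (fmapM LG) (fmapM LG') -!compA.
have e := mnat_natural (acounit_mnat p) (aunit q (G Z)); rewrite /= in e.
rewrite -!(fmapM LG') [X in fmap G' X]compA e -compA (zigzag2 p Z) compm1.
by rewrite (zigzag2 q).
Qed.

Definition adj_comp : adj (fcomp F F') (fcomp G' G) :=
  Adj comp_unit_mnat comp_counit_mnat comp_zigzag1 comp_zigzag2.
End CompAdj.

End Functors.

(** * Mates, closures and the twist *)

Section Mates.
Variables (k : fieldType) (C : tensorCategory k).
Implicit Types X Y Z W T : C.
Implicit Types F G H K : endo C.

(** The transpose f^* : G' -> G of f : F -> F' under the two adjunctions. *)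
Definition mate F G F' G' (p : adj F G) (q : adj F' G') (f : fam F F') :
    fam G' G :=
  fun Z => acounit q (G Z) \oc fmap G' (f (G Z)) \oc fmap G' (aunit p Z).

Section Mate.
Variables (F G F' G' : endo C).
Hypotheses (LF : lawful F) (LG : lawful G) (LF' : lawful F') (LG' : lawful G').
Variables (p : adj F G) (q : adj F' G') (f : fam F F').
Hypothesis fM : is_mnat f.

Lemma mate_mnat : is_mnat (mate p q f).
Proof.
rewrite /mate.
have a := mnat_whiskr G (acounit_mnat q).
have b := mnat_whiskl LG' (mnat_whiskr G fM).
have c := mnat_whiskl LG' (aunit_mnat p).
exact: mnat_comp (mnat_comp a b) c.
Qed.

(** A morphism slides through a cup or a cap, turning into its mate. *)
Lemma mate_co Z : acounit p Z \oc mate p q f (F Z) = acounit q Z \oc fmap G' (f Z).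
Proof.
have e := mnat_natural (acounit_mnat q) (acounit p Z); rewrite /= in e.
rewrite /mate -(compA (acounit q _)) -(fmapM LG') compA -e -compA -(fmapM LG').
rewrite compA -(mnat_natural fM (acounit p Z)) -compA (zigzag1 p) compm1 //.
Qed.

Lemma mate_un Z : fmap F' (mate p q f Z) \oc aunit q Z = f (G Z) \oc aunit p Z.
Proof.
have e := mnat_natural (aunit_mnat q) (f (G Z) \oc aunit p Z); rewrite /= in e.
rewrite /mate -(compA (acounit q _)) -(fmapM LG') (fmapM LF') -compA -e.
by rewrite [LHS]compA (zigzag1 q) comp1m.
Qed.

End Mate.

(** F has G as a left ([ladj]) and as a right ([radj]) adjoint; for X (x) - this
    is a two-sided dual of X, equivalently an isomorphism X -> X^**. *)
Record ambi F G := Ambi { ladj : adj F G; radj : adj G F }.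

Definition ambi_comp F G F' G' (LF : lawful F) (LG : lawful G)
    (LF' : lawful F') (LG' : lawful G') (p : ambi F G) (q : ambi F' G') :
    ambi (fcomp F F') (fcomp G' G) :=
  Ambi (adj_comp LF LG LF' LG' (ladj p) (ladj q))
    (adj_comp LG' LF' LG LF (radj q) (radj p)).

(** Closing the strand F on the right of H, respectively on the left of K. *)
Definition rtrace F G (p : ambi F G) H (h : fam (fcomp H F) (fcomp H F)) :
    fam H H :=
  fun Z => fmap H (acounit (radj p) Z) \oc h (G Z) \oc fmap H (aunit (ladj p) Z).

Definition ltrace F G (p : ambi F G) K (h : fam (fcomp F K) (fcomp F K)) :
    fam K K :=
  fun Z => acounit (ladj p) (K Z) \oc fmap G (h Z) \oc aunit (radj p) (K Z).

(** The double transpose, once with the left and once with the right adjoints: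
    the double dual of f, seen as a transformation F -> F' again. *)
Definition twist F G F' G' (p : ambi F G) (q : ambi F' G') (f : fam F F') :
    fam F F' :=
  mate (radj q) (radj p) (mate (ladj p) (ladj q) f).

Lemma rtrace_mnat F G (p : ambi F G) H (h : fam (fcomp H F) (fcomp H F)) :
  lawful H -> is_mnat h -> is_mnat (rtrace p h).
Proof.
move=> LH hM; rewrite /rtrace.
have a := mnat_whiskl LH (acounit_mnat (radj p)).
have c := mnat_whiskl LH (aunit_mnat (ladj p)).
exact: mnat_comp (mnat_comp a (mnat_whiskr G hM)) c.
Qed.

Lemma ltrace_mnat F G (p : ambi F G) K (h : fam (fcomp F K) (fcomp F K)) :
  lawful G -> is_mnat h -> is_mnat (ltrace p h).
Proof.
move=> LG hM; rewrite /ltrace.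
have a := mnat_whiskr K (acounit_mnat (ladj p)).
have c := mnat_whiskr K (aunit_mnat (radj p)).
exact: mnat_comp (mnat_comp a (mnat_whiskl LG hM)) c.
Qed.

Section Twist.
Variables (F G F' G' : endo C).
Hypotheses (LF : lawful F) (LG : lawful G) (LF' : lawful F') (LG' : lawful G').
Variables (p : ambi F G) (q : ambi F' G') (f : fam F F') (g : fam F' F).
Hypotheses (fM : is_mnat f) (gM : is_mnat g).

Lemma twist_mnat : is_mnat (twist p q f).
Proof. exact/mate_mnat/mate_mnat. Qed.

(** Sliding g, then f, around the closing strand: f passes one bend as its mate
    and comes back from the other one as its twist. *)
Lemma rtrace_twist Z :
  rtrace q (H := fid C) (fun Z => twist p q f Z \oc g Z) Z
    = rtrace p (H := fid C) (fun Z => g Z \oc f Z) Z.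
Proof.
rewrite /rtrace /twist /=.
have M := mate_mnat LG' (ladj p) (ladj q) fM.
have := mate_un LF' LG' (ladj p) (ladj q) f Z.
have := mate_co LF (radj q) (radj p) M Z; rewrite /=.
move: (mate (ladj p) (ladj q) f) M (mate (radj q) (radj p) _) => m M Tf e1 e2.
rewrite -!compA (comp_precomp e1) -!compA -e2.
by rewrite (comp_precomp (mnat_natural gM _)) -!compA.
Qed.

Lemma ltrace_twist Z :
  ltrace q (K := fid C) (fun Z => f Z \oc g Z) Z
    = ltrace p (K := fid C) (fun Z => g Z \oc twist p q f Z) Z.
Proof.
rewrite /ltrace /twist /=.
have M := mate_mnat LG' (ladj p) (ladj q) fM.
have := mate_co LG' (ladj p) (ladj q) fM Z.
have := mate_un LG LF (radj q) (radj p) (mate (ladj p) (ladj q) f) Z; rewrite /=.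
move: (mate (ladj p) (ladj q) f) M (mate (radj q) (radj p) _) => m M Tf e1 e2.
rewrite !fmapM // -!compA (comp_precomp (esym e2)) -!compA.
by rewrite e1 (comp_precomp (mnat_natural M (g Z))) -!compA.
Qed.

End Twist.

(** The closing strands of the two factors are on opposite sides of the diagram,
    so one may close them in any order: this is naturality of the unit and the
    counit of F. *)
Lemma ltrace_rtrace F G F' G' (LG : lawful G) (p : ambi F G) (q : ambi F' G')
    (h : fam (fcomp F F') (fcomp F F')) Z :
  is_mnat h ->
  ltrace p (K := fid C) (rtrace q h) Z = rtrace q (H := fid C) (ltrace p h) Z.
Proof.
move=> hM; rewrite /ltrace /rtrace /= !fmapM // -!compA.
have e := mnat_natural (aunit_mnat (radj p)) (aunit (ladj q) Z); rewrite /= in e.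
rewrite -e.
have e' := mnat_natural (acounit_mnat (ladj p)) (acounit (radj q) Z).
rewrite /= in e'.
by rewrite (comp_precomp e') -!compA.
Qed.

Section Comp.
Variables (F G F' G' : endo C).
Hypotheses (LF : lawful F) (LG : lawful G) (LF' : lawful F') (LG' : lawful G').
Variables (p : ambi F G) (q : ambi F' G') (h : fam (fcomp F F') (fcomp F F')).

Lemma rtrace_comp Z :
  rtrace (ambi_comp LF LG LF' LG' p q) (H := fid C) h Z
    = rtrace p (H := fid C) (rtrace q h) Z.
Proof. by rewrite /rtrace /= /comp_unit /comp_counit /= -!compA. Qed.

Lemma ltrace_comp Z :
  ltrace (ambi_comp LF LG LF' LG' p q) (K := fid C) h Z
    = ltrace q (K := fid C) (ltrace p h) Z.
Proof. by rewrite /ltrace /= /comp_unit /comp_counit /= !fmapM // -!compA. Qed.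
End Comp.

End Mates.

(** * Duals as adjunctions *)

Section Duals.
Variables (k : fieldType) (C : tensorCategory k).
Implicit Types X Y Z W T : C.
Local Notation I1 := (unit_obj : C).

Section Dual.
Variables (V D : C) (ev : hom (D \ox V) I1) (coev : hom I1 (V \ox D)).
Hypothesis dP : is_dual ev coev.

Definition dual_unit : fam (fid C) (fcomp (ltens V) (ltens D)) :=
  fun Z => assoc V D Z \oc (coev \om idm Z) \oc lunitV Z.
Definition dual_counit : fam (fcomp (ltens D) (ltens V)) (fid C) :=
  fun Z => lunit Z \oc (ev \om idm Z) \oc assocV D V Z.

Lemma dual_unit_mnat : is_mnat dual_unit.
Proof.
exact: mnat_comp (mnat_comp (assocf_mnat V D) (lift_mnat coev)) (lunitVf_mnat C).
Qed.

Lemma dual_counit_mnat : is_mnat dual_counit.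
Proof.
exact: mnat_comp (mnat_comp (lunitf_mnat C) (lift_mnat ev)) (assocVf_mnat D V).
Qed.

(** The first zigzag of the dual pair, tensored with Z: all associators are
    moved to the outside by the pentagon and naturality, and the unit
    constraints are absorbed by the triangle and [lunit_tens]. *)
Lemma dual_zigzag1 Z :
  fmap (ltens V) (dual_counit Z) \oc dual_unit (ltens V Z) = idm (ltens V Z).
Proof.
case: dP => e _; rewrite /dual_unit /dual_counit /= !tensm_compr.
have t : idm V \om lunit Z = (runit V \om idm Z) \oc assocV V I1 Z.
  by rewrite -triangle -compA assocKV compm1.
have pe : assocV V (D \ox V) Z \oc ((idm V \om assocV D V Z)
    \oc assoc V D (V \ox Z))
    = (assoc V D V \om idm Z) \oc assocV (V \ox D) V Z.
  apply: (iso_cancell (assocK V (D \ox V) Z)).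
  rewrite compA assocKV comp1m.
  apply: (iso_cancell (tensm_inverse (is_inverse1 V) (assocK D V Z))).
  rewrite (compA (idm V \om assoc D V Z)) -tensm_compr assocKV tensm1 comp1m.
  apply: (iso_cancelr (assocK (V \ox D) V Z)).
  by rewrite pentagon -!compA assocVK compm1.
have aunit : assocV I1 V Z \oc lunitV (V \ox Z) = lunitV V \om idm Z.
  apply: (iso_cancell (tensm_inverse (lunitK V) (is_inverse1 Z))).
  rewrite -tensm_compl lunitKV tensm1 -lunit_tens -compA (compA (assoc _ _ _)).
  by rewrite assocKV comp1m lunitKV.
rewrite t -tensm1 -!compA.
rewrite (comp_precomp (assocV_nat (idm V) ev (idm Z))) -!compA.
rewrite (comp_precomp2 pe) -!compA.
rewrite (comp_precomp (assocV_nat coev (idm V) (idm Z))) -!compA aunit.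
by rewrite -!tensm_compl !compA e.
Qed.

Lemma dual_zigzag2 Z :
  dual_counit (ltens D Z) \oc fmap (ltens D) (dual_unit Z) = idm (ltens D Z).
Proof.
case: dP => _ e; rewrite /dual_unit /dual_counit /= !tensm_compr.
have t : idm D \om lunitV Z = assoc D I1 Z \oc (runitV D \om idm Z).
  apply: (iso_cancell (tensm_inverse (is_inverse1 D) (lunitK Z))).
  rewrite -tensm_compr lunitKV tensm1 compA triangle -tensm_compl.
  by rewrite runitKV tensm1.
have pe : assocV D V (D \ox Z) \oc ((idm D \om assoc V D Z)
    \oc assoc D (V \ox D) Z)
    = assoc (D \ox V) D Z \oc (assocV D V D \om idm Z).
  apply: (iso_cancell (assocK D V (D \ox Z))).
  rewrite compA assocKV comp1m [RHS]compA pentagon -!compA.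
  by rewrite -tensm_compl assocKV tensm1 compm1.
rewrite t -tensm1 -!compA.
rewrite (comp_precomp (esym (assoc_nat (idm D) coev (idm Z)))) -!compA.
rewrite (comp_precomp2 pe) -!compA.
rewrite (comp_precomp (esym (assoc_nat ev (idm D) (idm Z)))) -!compA.
by rewrite (comp_precomp (lunit_tens D Z)) -!tensm_compl !compA e.
Qed.

Definition adj_of_dual : adj (ltens V) (ltens D) :=
  Adj dual_unit_mnat dual_counit_mnat dual_zigzag1 dual_zigzag2.
End Dual.

(** For replacing V^** by V in the adjunction between V^* and V^**. *)
Section Transport.
Variables (F G G' : endo C).
Hypotheses (LF : lawful F) (LG : lawful G) (LG' : lawful G').
Variables (p : adj F G) (al : fam G' G) (be : fam G G').
Hypotheses (alM : is_mnat al) (beM : is_mnat be).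
Hypothesis K : forall Z, is_inverse (al Z) (be Z).

Definition transport_unit : fam (fid C) (fcomp F G') :=
  fun Z => fmap F (be Z) \oc aunit p Z.
Definition transport_counit : fam (fcomp G' F) (fid C) :=
  fun Z => acounit p Z \oc al (F Z).

Lemma transport_unit_mnat : is_mnat transport_unit.
Proof. exact: mnat_comp (mnat_whiskl LF beM) (aunit_mnat p). Qed.

Lemma transport_counit_mnat : is_mnat transport_counit.
Proof. exact: mnat_comp (acounit_mnat p) (mnat_whiskr F alM). Qed.

Lemma transport_zigzag1 Z :
  fmap F (transport_counit Z) \oc transport_unit (F Z) = idm (F Z).
Proof.
rewrite /transport_counit /transport_unit compA -(fmapM LF) -compA.
case: (K (F Z)) => _ ->.
by rewrite compm1 (zigzag1 p).
Qed.

Lemma transport_zigzag2 Z :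
  transport_counit (G' Z) \oc fmap G' (transport_unit Z) = idm (G' Z).
Proof.
have e := mnat_natural (acounit_mnat p) (be Z); rewrite /= in e.
rewrite /transport_counit /transport_unit -compA (mnat_natural alM) (fmapM LG).
rewrite !compA /= e.
rewrite -(compA (be Z)) (zigzag2 p) compm1; by case: (K Z).
Qed.

Definition adj_transport : adj F G' :=
  Adj transport_unit_mnat transport_counit_mnat transport_zigzag1 transport_zigzag2.
End Transport.

End Duals.

Section Pivot.
Variables (k : fieldType) (C : fusionCategory k).
Implicit Types X Y Z V W : C.
Local Notation I1 := (unit_obj : C).

Definition dual_adj V : adj (ltens V) (ltens (dual V)) := adj_of_dual (dualP V).

Lemma lift_inverse X Y (a : hom X Y) (b : hom Y X) :
  is_inverse a b -> forall Z, is_inverse (lift a Z) (lift b Z).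
Proof. by move=> ab Z; apply: tensm_inverse ab (is_inverse1 Z). Qed.

(** V^* is a dual of V, and V^** is one of V^*; the isomorphism of V with V^**
    makes V^* also a dual of V on the other side. *)
Definition pivot V (a : hom V (dual (dual V))) (b : hom (dual (dual V)) V)
    (ab : is_inverse a b) : ambi (ltens V) (ltens (dual V)) :=
  Ambi (dual_adj V)
    (adj_transport (lawful_tens (dual V)) (lawful_tens (dual (dual V)))
       (dual_adj (dual V)) (lift_mnat a) (lift_mnat b) (lift_inverse ab)).

Lemma trace_lift V (g : hom V (dual (dual V))) Z :
  acounit (dual_adj (dual V)) Z \oc lift g (dual V \ox Z) \oc aunit (dual_adj V) Z
    = trace g *: idm Z.
Proof.
rewrite /= /dual_counit /dual_unit /lift -!compA -tensm1.
rewrite (comp_precomp (esym (assoc_nat g (idm (dual V)) (idm Z)))) -!compA.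
rewrite (comp_precomp (assocVK _ _ _)) comp1m.
rewrite (comp_precomp (esym (tensm_compl _ _ _))).
rewrite (comp_precomp (esym (tensm_compl _ _ _))) /trace.
rewrite -[X in (X \om _) \oc _]scalar_ofE.
by rewrite tensmZl compZl compZr tensm1 comp1m lunitKV.
Qed.

(** [dualm] f was defined as the component at the unit object of the mate of f,
    up to unit constraints; a module transformation is determined by that
    component. *)
Lemma mate_lift X Y (f : hom X Y) Z :
  mate (dual_adj X) (dual_adj Y) (lift f) Z = lift (dualm f) Z.
Proof.
have M := mate_mnat (lawful_tens (dual Y)) (dual_adj X) (dual_adj Y) (lift_mnat f).
rewrite (lift_desc M); congr (lift _ Z).
rewrite /desc /mate.
have e1 := mnat_natural (acounit_mnat (dual_adj Y)) (runit (dual X)).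
have e2 : (idm X \om runit (dual X)) \oc dual_unit (coev X) I1 = coev X.
  rewrite /dual_unit !compA runit_tens runit_nat -compA -lunit1 lunitKV.
  by rewrite compm1.
rewrite /= /dual_counit !compA in e1.
rewrite /= !compA -e1 /lift /dual_counit /dualm -!compA.
congr (_ \oc (_ \oc (_ \oc _))).
rewrite !compA; congr (_ \oc _).
by rewrite -!tensm_compr -tensm_exch -compA e2.
Qed.

(** The left closure of V contains b, the trace of [dualm] b its transpose; the
    transpose slides back through the evaluation. *)
Lemma ldim_pivot V (a : hom V (dual (dual V))) b (ab : is_inverse a b) Z :
  acounit (ladj (pivot ab)) Z \oc aunit (radj (pivot ab)) Z
    = trace (dualm b) *: idm Z :> hom (Z : C) Z.
Proof.
rewrite -trace_lift -mate_lift.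
rewrite (mate_co (lawful_tens (dual V)) (dual_adj (dual (dual V)))
  (dual_adj V) (lift_mnat b)).
by rewrite /= /transport_unit /= compA.
Qed.

Lemma rdim_pivot V (a : hom V (dual (dual V))) b (ab : is_inverse a b) Z :
  acounit (radj (pivot ab)) Z \oc aunit (ladj (pivot ab)) Z
    = trace a *: idm Z :> hom (Z : C) Z.
Proof. by rewrite -trace_lift. Qed.
End Pivot.

(** * Exchange of left and right closures for simple objects *)

Section Coef.
Variables (k : fieldType) (C : linCategory k).
Implicit Types X Y Z : C.

(** Over an algebraically closed field and in a semisimple category, the simple
    objects; the part of the argument that draws diagrams needs only this. *)
Definition brick X := idm X <> 0 /\ forall e : hom X X, exists c, e = c *: idm X.

Definition coef X (e : hom X X) : k := coord [tuple idm X] ord0 e.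

Lemma coefE X (e : hom X X) : brick X -> coef e *: idm X = e.
Proof.
case=> _ /(_ e) [c ec].
have f_span : e \in <<[tuple idm X]>>%VS.
  by rewrite span_seq1; apply/vlineP; exists c.
by rewrite {2}(coord_span f_span) big_ord1.
Qed.

Lemma scale_id_inj X (c d : k) : idm X <> 0 -> c *: idm X = d *: idm X -> c = d.
Proof.
move=> X0 /eqP; rewrite -subr_eq0 -scalerBl scaler_eq0 subr_eq0.
by case/orP=> /eqP.
Qed.

Lemma coef_id X c : brick X -> coef (c *: idm X) = c.
Proof. by move=> bX; apply: (@scale_id_inj X) bX.1 _; rewrite coefE. Qed.

Lemma coef0 X : coef (0 : hom X X) = 0.
Proof. exact: linear0. Qed.
Lemma coefZ X c (e : hom X X) : coef (c *: e) = c * coef e.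
Proof. exact: linearZ. Qed.
Lemma coef_sum X I (r : seq I) (P : pred I) (e : I -> hom X X) :
  coef (\sum_(i <- r | P i) e i) = \sum_(i <- r | P i) coef (e i).
Proof. exact: linear_sum. Qed.

End Coef.

Section Pivotal.
Variables (k : fieldType) (C : tensorCategory k).
Implicit Types X Y Z : C.
Local Notation I1 := (unit_obj : C).

Lemma mnat_scalar X (al : fam (ltens X) (ltens X)) :
  brick X -> is_mnat al ->
  forall Z, al Z = coef (desc al) *: idm (X \ox Z).
Proof.
move=> bX alM Z.
by rewrite (lift_desc alM) /lift -[X in X \om _]coefE // tensmZl tensm1.
Qed.

(** Left and right dimension are equal to d, as for the normalised choice of
    V -> V^**. *)
Definition is_dim F G (p : ambi (C := C) F G) (d : k) :=
  forall Z : C, acounit (radj p) Z \oc aunit (ladj p) Z = d *: idm Z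
             /\ acounit (ladj p) Z \oc aunit (radj p) Z = d *: idm Z.

Lemma rtrace_scalar F G (p : ambi F G) (d c : k) (h : fam F F) :
  is_dim p d -> (forall Z, h Z = c *: idm (F Z)) ->
  forall Z : C, rtrace p (H := fid C) h Z = (c * d) *: idm Z.
Proof.
move=> pd hc Z; rewrite /rtrace /= hc compZr compm1 compZl.
by case: (pd Z) => -> _; rewrite scalerA.
Qed.

Lemma ltrace_scalar F G (p : ambi F G) (d c : k) (h : fam F F) : lawful G ->
  is_dim p d -> (forall Z, h Z = c *: idm (F Z)) ->
  forall Z : C, ltrace p (K := fid C) h Z = (c * d) *: idm Z.
Proof.
move=> LG pd hc Z; rewrite /ltrace /= hc fmapZ // fmap1 // compZr compm1 compZl.
by case: (pd Z) => _ ->; rewrite scalerA.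
Qed.

(** The left partial trace, on morphisms of C; compared with [ltrace] by
    [desc_ltrace]. *)
Definition ptrace F G (p : ambi F G) Y Z (h : hom (F Y) (F Z)) : hom (Y : C) Z :=
  acounit (ladj p) Z \oc fmap G h \oc aunit (radj p) Y.

Section Lift2.
Variables (a b c : C).

Definition lift2 (f : hom c (a \ox b)) :
    fam (ltens c) (fcomp (ltens a) (ltens b)) :=
  fun Z => assocf a b Z \oc lift f Z.
Definition lift2V (g : hom (a \ox b) c) :
    fam (fcomp (ltens a) (ltens b)) (ltens c) :=
  fun Z => lift g Z \oc assocVf a b Z.

Lemma lift2_mnat f : is_mnat (lift2 f).
Proof. exact: mnat_comp (assocf_mnat a b) (lift_mnat f). Qed.

Lemma lift2V_mnat g : is_mnat (lift2V g).
Proof. exact: mnat_comp (lift_mnat g) (assocVf_mnat a b). Qed.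

Lemma lift2_surj t : is_mnat t -> exists f, forall Z, t Z = lift2 f Z.
Proof.
move=> tM; have M := mnat_comp (assocVf_mnat a b) tM.
exists (desc (fun Z => assocVf a b Z \oc t Z)) => Z.
rewrite /lift2 -(lift_desc M) /assocf /assocVf.
by rewrite compA (assocKV a b Z) comp1m.
Qed.

Lemma desc_ltrace G (p : ambi (ltens a) G) (LG : lawful G) f g :
  desc (ltrace p (K := ltens b) (fun Z => lift2 f Z \oc lift2V g Z))
    = ptrace p (f \oc g).
Proof.
rewrite /desc /ltrace /ptrace.
have e1 := mnat_natural (acounit_mnat (ladj p)) (runit b); rewrite /= in e1.
have e2 := mnat_natural (aunit_mnat (radj p)) (runitV b); rewrite /= in e2.
rewrite -!compA e2 !compA -e1 -!compA; congr (_ \oc _).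
rewrite !compA -!fmapM //; congr (fmap G _ \oc _).
rewrite /lift2 /lift2V /assocf /assocVf /lift !compA runit_tens.
rewrite runit_nat -!compA; congr (_ \oc _).
rewrite (comp_precomp (runit_nat g)) -!compA -runit_tens -!compA.
rewrite (comp_precomp (assocKV _ _ _)) comp1m -tensm_compr runitKV tensm1.
by rewrite compm1.
Qed.
End Lift2.

Section Exchange.
Variables (a b c : C) (A B D : endo C).
Variables (p : ambi (ltens a) A) (q : ambi (ltens b) B) (r : ambi (ltens c) D).
Hypotheses (LA : lawful A) (LB : lawful B) (LD : lawful D).
Variables (da db dc : k).
Hypotheses (pd : is_dim p da) (qd : is_dim q db) (rd : is_dim r dc).
Hypotheses (b1 : brick I1) (ba : brick a) (bb : brick b) (bc : brick c).

(** The relation between f and its twist f2.  Close the endomorphism f2 g of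
    a (x) b on the right: [rtrace_twist] gives dc times the scalar of g f, while
    closing b leaves a scalar on a.  Closing that on the left instead of the
    right does not change the value, as both dimensions of a are da; and then
    [ltrace_rtrace] allows to close a first, which leaves the scalar of
    [ptrace] p (f2 g) on b, to be multiplied by db.  The other equation closes
    f g on the left. *)
Lemma pivotal_exchange (f : hom c (a \ox b)) : exists f2, forall g,
  dc * coef (g \oc f2) = db * coef (ptrace p (f \oc g)) /\
  dc * coef (g \oc f) = db * coef (ptrace p (f2 \oc g)).
Proof.
have [La Lb Lc] := And3 (lawful_tens a) (lawful_tens b) (lawful_tens c).
pose pq := ambi_comp La LA Lb LB p q.
have LAB := lawful_comp LB LA; have Lab := lawful_comp La Lb.
have fM := lift2_mnat f.
have tM := twist_mnat Lc LAB r pq fM.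
have [f2 tE] := lift2_surj tM; exists f2 => g.
have tE' : twist r pq (lift2 f) = lift2 f2.
  exact: functional_extensionality_dep.
have f2M := lift2_mnat f2; have gM := lift2V_mnat g.
have close (f' : hom c (a \ox b)) Z :
    ltrace p (K := ltens b) (fun Z => lift2 f' Z \oc lift2V g Z) Z
      = coef (ptrace p (f' \oc g)) *: idm (b \ox Z).
  have M : is_mnat (ltrace p (K := ltens b) (fun Z => lift2 f' Z \oc lift2V g Z)).
    apply: ltrace_mnat LA _.
    exact: mnat_comp (lift2_mnat f') gM.
  by rewrite (mnat_scalar bb M) desc_ltrace.
have opn (f' : hom c (a \ox b)) Z :
    lift2V g Z \oc lift2 f' Z = coef (g \oc f') *: idm (c \ox Z).
  rewrite /lift2 /lift2V /assocf /assocVf -!compA.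
  rewrite (comp_precomp (assocVK a b Z)) comp1m /lift -tensm_compl.
  by rewrite -[X in X \om _](coefE _ bc) tensmZl tensm1.
split; apply: (scale_id_inj b1.1).
  have := ltrace_twist Lc LD LAB r pq (lift2V g) fM I1.
  rewrite tE' (ltrace_scalar LD rd (opn f2)) ltrace_comp.
  rewrite (ltrace_scalar LB qd (close f)).
  by rewrite ![_ * dc]mulrC ![_ * db]mulrC => ->.
have := rtrace_twist Lc Lab LAB r pq fM gM I1.
rewrite tE' (rtrace_scalar rd (opn f)) rtrace_comp.
have M : is_mnat (rtrace q (H := ltens a) (fun Z => lift2 f2 Z \oc lift2V g Z)).
  apply: (rtrace_mnat q La); exact: mnat_comp f2M gM.
(* the right closure of the strand a is replaced by the left one *)
rewrite (rtrace_scalar pd (mnat_scalar ba M)).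
rewrite -(ltrace_scalar LA pd (mnat_scalar ba M)).
rewrite (ltrace_rtrace LA p q) //; last exact: mnat_comp f2M gM.
rewrite (rtrace_scalar qd (close f2)).
by rewrite ![_ * dc]mulrC ![_ * db]mulrC => ->.
Qed.
End Exchange.
End Pivotal.

(** * Schur's lemma *)

Import VectorInternalTheory.

Section Schur.
Variables (k : closedFieldType) (C : linCategory k).
Implicit Types X Y Z W : C.
Hypothesis ss : is_semisimple C.

Lemma id_eq0_zero X : idm X = 0 -> is_zero_obj X.
Proof.
by move=> X0; split=> Y f; [rewrite -(compm1 f)|rewrite -(comp1m f)];
  rewrite X0 ?compr0 ?comp0r.
Qed.

Lemma simple_id_neq0 X : is_simple X -> idm X <> 0.
Proof. by case=> nz _ /id_eq0_zero. Qed.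

Lemma schur X Y (f : hom X Y) : is_simple X -> is_simple Y -> f <> 0 -> is_iso f.
Proof.
move=> [nzX sX] [nzY sY] f0.
have [_ /(_ _ _ f) [K [i [fi0 iU]]] _ _ _] := ss.1.
have iM : is_mono i.
  move=> W g h e.
  have fig0 : f \oc (i \oc g) = 0 by rewrite compA fi0 comp0r.
  have [u [ug uU]] := iU W (i \oc g) fig0.
  by rewrite -(uU g) // -(uU h).
have [zK|[j [ij ji]]] := sX K i iM; last first.
  by case: f0; rewrite -(compm1 f) -ji compA fi0 comp0r.
have fM : is_mono f.
  move=> W g h e.
  have d0 : f \oc (g - h) = 0 by rewrite compDr compNr e subrr.
  have [u [ug _]] := iU W _ d0.
  by apply/eqP; rewrite -subr_eq0 -ug (zK.2 _ u) compr0.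
by have [/nzX//|] := sY X f fM.
Qed.

HB.instance Definition _ X Y Z (g : hom Y Z) :=
  GRing.isLinear.Build k (hom X Y) (hom X Z) _ (comp g) (comp_linearr g).

(** Composition with f is an endomorphism of the finite dimensional space
    End(X), so it has an eigenvector. *)
Lemma comp_eigenvector X (f : hom X X) : idm X <> 0 ->
  exists (c : k) (h : hom X X), h <> 0 /\ f \oc h = c *: h.
Proof.
move=> X0.
pose A := lin1_mx (v2r \o (comp f : hom X X -> hom X X) \o r2v).
have AE v : v2r (f \oc r2v v) = v *m A by rewrite mul_rV_lin1.
have dim_gt0 : size (char_poly A) != 1%N.
  rewrite size_char_poly eqSS; apply/eqP => d0; case: X0.
  apply: (can_inj v2rK); apply/rowP => -[i lti]; exfalso.
  by rewrite d0 in lti.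
have [c] := closed_rootP _ dim_gt0.
rewrite -eigenvalue_root_char => /eigenvalueP [v vA v0].
exists c, (r2v v); split.
  by move=> v0'; move: v0; rewrite -(r2vK v) v0' linear0 eqxx.
by apply: (can_inj v2rK); rewrite AE vA linearZ /= r2vK.
Qed.

Lemma simple_brick X : is_simple X -> brick X.
Proof.
move=> sX; have X0 := simple_id_neq0 sX; split=> // f.
have [c [h [h0 fh]]] := comp_eigenvector f X0.
exists c; apply: contrapT => fc.
have [g [gf _]] : is_iso (f - c *: idm X).
  apply: schur => // e; apply: fc; apply/eqP; rewrite -subr_eq0; exact/eqP.
case: h0; rewrite -(comp1m h) -gf -compA.
by rewrite compDl compNl compZl comp1m fh subrr compr0.
Qed.

End Schur.

(** * Semisimplicity, and the isomorphism of V with its double dual *)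

Section Semisimple.
Variables (k : closedFieldType) (C : linCategory k).
Implicit Types X Y Z W V : C.
Hypothesis ss : is_semisimple C.

Lemma iso_simple X Y : isomorphic X Y -> is_simple X -> is_simple Y.
Proof.
move=> [f [g fg]] [nzX sX]; have [gf fg1] := fg; split.
  move=> [Y0 _]; apply: nzX; apply: id_eq0_zero.
  by rewrite -gf -(comp1m f) (Y0 _ (idm Y)) comp0r compr0.
move=> W i iM.
have giM : is_mono (g \oc i).
  move=> Z u v; rewrite -!compA => e; apply: iM.
  exact: (iso_cancell (is_inverse_sym fg) e).
have [W0|[h [h1 h2]]] := sX W _ giM; [by left|right].
exists (h \oc g); split; first by rewrite -compA.
apply: (iso_cancell (is_inverse_sym fg)).
by rewrite !compA h2 comp1m compm1.
Qed.

Lemma simple_summand V Y (w : hom V Y) : is_simple V -> w <> 0 ->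
  exists u, u \oc w = idm V.
Proof.
move=> sV w0; have [m [S [sS [i [p [_ _ id_sum]]]]]] := ss.2 Y.
have [j pw0] : exists j, p j \oc w <> 0.
  apply: contrapT => /forallNP pw0; apply: w0.
  rewrite -(comp1m w) -id_sum comp_suml big1 // => j _.
  by rewrite -compA; have /contrapT -> := pw0 j; rewrite compr0.
have [h [hK _]] := schur ss sV (sS j) pw0.
by exists (h \oc p j); rewrite -compA.
Qed.

Lemma brick_simple X : brick X -> is_simple X.
Proof.
move=> bX; have [X0 _] := bX.
have [m [S [sS [i [p [pi _ id_sum]]]]]] := ss.2 X.
have [j ip0] : exists j, i j \oc p j <> 0.
  apply: contrapT => /forallNP ip0; apply: X0.
  by rewrite -id_sum big1 // => j _; apply: contrapT; exact: ip0.
apply: iso_simple (sS j).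
have [c cE] := bX.2 (i j \oc p j).
have c0 : c <> 0 by move=> c0; apply: ip0; rewrite cE c0 scale0r.
exists (i j), (p j); split; first exact: pi.
have /eqP : c *: (c *: idm X) = c *: idm X.
  have : (i j \oc p j) \oc (i j \oc p j) = i j \oc p j.
    by rewrite -compA (compA (p j)) pi comp1m.
  by rewrite cE compZl comp1m.
rewrite -subr_eq0 -scalerBr scaler_eq0 subr_eq0.
by case/orP=> /eqP; [move/c0|rewrite cE].
Qed.

Section Transversal.
Variables (n : nat) (S : 'I_n -> C).
Hypothesis tS : is_simple_transversal S.

Lemma simple_hom0 j l (f : hom (S j) (S l)) : j != l -> f = 0.
Proof.
case: tS => sS _ injS /eqP jl; apply: contrapT => f0; apply: jl.
by apply: injS; exists f; exact: (schur ss).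
Qed.

(** The summands of Y, indexed for each simple type c by the same set: the maps
    belonging to a summand that is not of type c are put equal to 0.  This keeps
    the types of the maps independent of the summand. *)
Lemma decomposition Y : exists m
    (F : forall c, 'I_m -> hom (S c) Y) (G : forall c, 'I_m -> hom Y (S c)),
  \sum_c \sum_al (F c al \oc G c al) = idm Y.
Proof.
have [m [T [sT [i [p [_ _ id_sum]]]]]] := ss.2 Y.
have [sS coverS _] := tS.
have sigP al : {s | isomorphic (T al) (S s)} by apply: cid; exact: coverS.
have fgP c al : {fg : hom (S c) Y * hom Y (S c) |
    fg.1 \oc fg.2 = if c == tag (sigP al) then i al \oc p al else 0}.
  apply: cid; case: (sigP al) => s /= [f [g [gf fg]]].
  case: eqP => [->|_]; last by exists (0, 0); rewrite comp0r.
  exists (i al \oc g, f \oc p al) => /=.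
  by rewrite -compA (compA g) gf comp1m.
exists m, (fun c al => (projT1 (fgP c al)).1), (fun c al => (projT1 (fgP c al)).2).
rewrite exchange_big -id_sum; apply: eq_bigr => al _ /=.
rewrite (bigD1 (tag (sigP al))) //= (svalP (fgP _ al)) eqxx big1 ?addr0 // => c.
by move/negPf=> ne; rewrite (svalP (fgP _ al)) ne.
Qed.

Lemma eq_id Y (e : hom Y Y) :
  (forall c (x : hom (S c) Y), e \oc x = x) -> e = idm Y.
Proof.
move=> H; have [m [F [G FG]]] := decomposition Y.
rewrite -(compm1 e) -FG comp_sumr; apply: eq_bigr => c _.
by rewrite comp_sumr; apply: eq_bigr => al _; rewrite compA H.
Qed.

End Transversal.
End Semisimple.

Section Rigid.
Variables (k : closedFieldType) (C : fusionCategory k).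
Implicit Types X Y Z V W : C.
Local Notation I1 := (unit_obj : C).
Let ss := semisimpleP C.

Lemma unit_brick : brick I1.
Proof.
have [g gK Kg] := end_unit C; split=> [e|f]; last by exists (g f); rewrite Kg.
by have /eqP := oner_neq0 k; apply; rewrite -(gK 1) -(gK 0) e !scaler0.
Qed.

Lemma lift0 X Y Z : lift (0 : hom X Y) Z = 0.
Proof. by rewrite /lift tensm0l. Qed.

Lemma dual_counit_eq0 V : (forall Z, acounit (dual_adj V) Z = 0) -> idm V = 0.
Proof.
move=> co0; apply: tens_faithful1.
rewrite tensm1 tensm0l; have := zigzag1 (dual_adj V) I1.
by rewrite co0 fmap0 ?comp0r; [move=> <-|exact: lawful_tens].
Qed.

Lemma dual_unit_eq0 V : (forall Z, aunit (dual_adj V) Z = 0) -> idm V = 0.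
Proof.
move=> un0; apply: tens_faithful1.
rewrite tensm1 tensm0l; have := zigzag1 (dual_adj V) I1.
by rewrite un0 compr0 => <-.
Qed.

(** An endomorphism e of V^* bends into one of V, hence is a scalar. *)
Lemma brick_dual V : brick V -> brick (dual V).
Proof.
move=> bV; have [V0 _] := bV.
have LV := lawful_tens V; have LD := lawful_tens (dual V).
split=> [D0|e].
  apply/V0/dual_counit_eq0 => Z; rewrite -(compm1 (acounit _ _)) /=.
  by rewrite -tensm1 D0 tensm0l compr0.
pose E : fam (ltens V) (ltens V) := fun Z =>
  fmap (ltens V) (acounit (dual_adj V) Z) \oc
    (fmap (ltens V) (lift e (V \ox Z)) \oc aunit (dual_adj V) (V \ox Z)).
have EM : is_mnat E.
  have a := mnat_whiskl LV (acounit_mnat (dual_adj V)).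
  have b := mnat_whiskl LV (mnat_whiskr (ltens V) (lift_mnat e)).
  have c := mnat_whiskr (ltens V) (aunit_mnat (dual_adj V)).
  exact: mnat_comp a (mnat_comp b c).
have Es := mnat_scalar bV EM; set s := coef _ in Es.
exists s; apply: tens_faithful1.
rewrite tensmZl tensm1.
have coe Z :
    acounit (dual_adj V) Z \oc lift e (V \ox Z) = s *: acounit (dual_adj V) Z.
  rewrite [LHS](adjunct_counit (dual_adj V) LD) (fmapM LV).
  rewrite -(compA (fmap _ (acounit _ _))) -/(E Z).
  by rewrite Es fmapZ // fmap1 // compZr compm1.
have e2 := zigzag2 (dual_adj V) I1.
have e3 := mnat_natural (lift_mnat e) (aunit (dual_adj V) I1).
rewrite -e2 -compZl -coe -compA e3 compA e2.
by rewrite comp1m.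
Qed.

Lemma dual_simple V : is_simple V -> is_simple (dual V).
Proof. by move=> sV; apply/(brick_simple ss)/brick_dual/(simple_brick ss). Qed.

Lemma unit_simple : is_simple I1.
Proof. exact/(brick_simple ss)/unit_brick. Qed.

(** By semisimplicity the unit splits off V (x) V^* through the coevaluation.
    A retraction V (x) V^* -> 1 bends into a morphism t : V -> V^**; composing
    it with the coevaluation computes the trace of t. *)
Lemma double_dual_hom V : is_simple V ->
  exists t : hom V (dual (dual V)), trace t = 1.
Proof.
move=> sV; have V0 := simple_id_neq0 sV.
have coev0 : coev V <> 0.
  move=> c0; apply/V0/dual_unit_eq0 => Z.
  by rewrite /= /dual_unit c0 tensm0l compr0 comp0r.
have [u uK] := simple_summand ss unit_simple coev0.
have LV := lawful_tens V.
pose U := dual_counit u.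
have UM : is_mnat (F := fcomp (ltens V) (ltens (dual V))) (G := fid C) U.
  exact: dual_counit_mnat.
pose T : fam (ltens V) (ltens (dual (dual V))) := fun Z =>
  U (dual (dual V) \ox Z) \oc fmap (ltens V) (aunit (dual_adj (dual V)) Z).
have TM : is_mnat T.
  have a := mnat_whiskr (ltens (dual (dual V))) UM.
  exact: mnat_comp a (mnat_whiskl LV (aunit_mnat (dual_adj (dual V)))).
have coT Z : acounit (dual_adj (dual V)) Z \oc T (dual V \ox Z) = U Z.
  have e := mnat_natural UM (acounit (dual_adj (dual V)) Z); rewrite /= in e.
  rewrite /T [LHS]compA -[X in X \oc _]e -compA -(fmapM LV).
  by rewrite [X in fmap _ X](zigzag1 (dual_adj (dual V)) Z) fmap1 // compm1.
exists (desc T); apply: (scale_id_inj unit_brick.1).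
rewrite -(trace_lift (desc T) I1) -(lift_desc TM) coT.
rewrite /U /dual_counit /= /dual_unit -!compA (comp_precomp (assocVK _ _ _)) comp1m.
rewrite (comp_precomp (esym (tensm_compl _ _ _))) uK tensm1 comp1m.
by rewrite lunitKV scale1r.
Qed.

Lemma trace0 V : trace (0 : hom V (dual (dual V))) = 0.
Proof. by rewrite /trace tensm0l compr0 comp0r /scalar_of linear0. Qed.

Lemma traceZ V c (g : hom V (dual (dual V))) : trace (c *: g) = c * trace g.
Proof. by rewrite /trace tensmZl compZr compZl /scalar_of linearZ. Qed.

Lemma dualmZ X Y c (f : hom X Y) : dualm (c *: f) = c *: dualm f.
Proof.
have tZ A B A' B' (x : hom A B) (y : hom A' B') :
    x \om (c *: y) = c *: (x \om y) :> hom (A \ox A' : C) _.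
  by have := tensm_linearr x c y 0; rewrite tensm0r !addr0.
by rewrite /dualm tensmZl tZ !(compZr, compZl).
Qed.

Lemma double_dual_iso V : is_simple V ->
  exists (a : hom V (dual (dual V))) b, is_inverse a b.
Proof.
move=> sV; have [t t1] := double_dual_hom sV.
have t0 : t <> 0 by move=> t0; have /eqP := oner_neq0 k; rewrite -t1 t0 trace0.
have [b tb] := schur ss sV (dual_simple (dual_simple sV)) t0.
by exists t, b.
Qed.

(** All morphisms V -> V^** are proportional to the one of trace 1. *)
Lemma trace_neq0 V (g : hom V (dual (dual V))) : is_simple V -> g <> 0 ->
  trace g != 0.
Proof.
move=> sV g0; have [t t1] := double_dual_hom sV.
have [h [hg gh]] := schur ss sV (dual_simple (dual_simple sV)) g0.
have [c cE] := (simple_brick ss sV).2 (h \oc t).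
have tE : t = c *: g by rewrite -(comp1m t) -gh -compA cE compZr compm1.
by apply/eqP => tg; have /eqP := oner_neq0 k; rewrite -t1 tE traceZ tg mulr0.
Qed.

Lemma dualm_iso_neq0 X Y (f : hom X Y) g : is_inverse f g -> idm Y <> 0 ->
  dualm f <> 0.
Proof.
move=> [_ fg] Y0 f0; apply/Y0/dual_counit_eq0 => Z.
have LY := lawful_tens (dual Y).
rewrite -(compm1 (acounit _ _)) /= -[X in _ \oc X](fmap1 LY).
rewrite -tensm1 -fg tensm_compl.
rewrite (fmapM LY) [LHS]compA.
have := mate_co LY (dual_adj X) (dual_adj Y) (lift_mnat f) Z.
by rewrite mate_lift f0 lift0 compr0 /= => <-; rewrite comp0r.
Qed.

(** Replacing a by s a multiplies Tr(a) by s and Tr((a^-1)^* ) by its inverse;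
    the traces become equal when s^2 is the ratio of the latter to the former. *)
Lemma normalized_pivot V : is_simple V ->
  exists d (p : ambi (ltens V) (ltens (dual V))),
    [/\ is_dim p d, d ^+ 2 = sqnorm V & d != 0].
Proof.
move=> sV; have [a0 [b0 ab0]] := double_dual_iso sV.
have [] := xgetPex 0 (P := [set x | exists (a : hom V (dual (dual V)))
   (b : hom (dual (dual V)) V),
    is_inverse a b /\ x = trace a * trace (dualm b)]%classic) _.
  by exists (trace a0 * trace (dualm b0)), a0, b0.
rewrite -/(sqnorm V) => a [b [ab ->]].
have V0 := simple_id_neq0 sV.
have ta : trace a != 0.
  apply: trace_neq0 => // a0'; apply: V0.
  by case: ab => <- _; rewrite a0' compr0.
have tb : trace (dualm b) != 0.
  apply: trace_neq0; first exact: dual_simple.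
  exact: (dualm_iso_neq0 (is_inverse_sym ab)).
have [s s2] : exists s : k, s ^+ 2 = trace (dualm b) / trace a.
  have [s] := @solve_monicpoly k 2
    (fun i => if i == 0%N then trace (dualm b) / trace a else 0) isT.
  by rewrite !big_ord_recl big_ord0 /= expr0 mulr1 mul0r !addr0 => ?; exists s.
have s0 : s != 0.
  by rewrite -sqrf_eq0 s2 mulf_neq0 // invr_neq0.
have ab' : is_inverse (s *: a) (s^-1 *: b).
  case: ab => ba ab; split; rewrite compZl compZr ?ab ?ba scalerA.
    by rewrite mulVf // scale1r.
  by rewrite mulfV // scale1r.
exists (s * trace a), (pivot ab'); split.
- move=> Z; rewrite rdim_pivot ldim_pivot traceZ dualmZ traceZ; split=> //.
  congr (_ *: _); apply: (mulfI s0); rewrite mulrA mulfV // mul1r mulrA.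
  by rewrite -expr2 s2 divfK.
- by rewrite exprMn s2 expr2 mulrA divfK // mulrC.
by rewrite mulf_neq0.
Qed.

End Rigid.

(** * Fusion matrices *)

Section Rotation.
Variables (k : fieldType) (C : tensorCategory k) (F G : endo C).
Hypotheses (LF : lawful F) (LG : lawful G).
Variable p : ambi F G.
Implicit Types X Y Z W : C.

Definition ambi_swap : ambi G F := Ambi (radj p) (ladj p).

(** [bendl] bends the strand F from the target to the source, [bendr] from the
    source to the target.  Composing the results closes F on the left, and
    closing the strand G of the opposite composite undoes the bending
    ([bendl_bendr], [ptrace_swap]). *)
Definition bendl X Z (f : hom X (F Z)) : hom (G X) Z :=
  acounit (ladj p) Z \oc fmap G f.
Definition bendr X Z (g : hom (F X) Z) : hom X (G Z) :=
  fmap G g \oc aunit (radj p) X.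

Lemma bendl_bendr X Y Z (f : hom X (F Z)) (g : hom (F Y) X) :
  bendl f \oc bendr g = ptrace p (f \oc g).
Proof. by rewrite /bendl /bendr /ptrace fmapM // !compA. Qed.

Lemma ptrace_swap X Y Z (f : hom X (F Y)) (g : hom (F Y) Z) :
  ptrace ambi_swap (bendr g \oc bendl f) = g \oc f.
Proof.
rewrite /ptrace /= fmapM // !compA -(compA _ _ (aunit _ _)).
by rewrite -(adjunct_unit (ladj p) LF f) -(adjunct_counit (radj p) LF g).
Qed.

Lemma bendr_surj X Z (x : hom X (G Z)) : exists g, x = bendr g.
Proof. by exists (acounit (radj p) Z \oc fmap F x); exact: adjunct_unit. Qed.

Lemma ptraceD Y Z (h1 h2 : hom (F Y) (F Z)) :
  ptrace p (h1 + h2) = ptrace p h1 + ptrace p h2.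
Proof. by rewrite /ptrace fmapD // compDr compDl. Qed.

Lemma ptraceZ Y Z c (h : hom (F Y) (F Z)) : ptrace p (c *: h) = c *: ptrace p h.
Proof. by rewrite /ptrace fmapZ // compZr compZl. Qed.

Lemma ptrace0 Y Z : ptrace p (0 : hom (F Y) (F Z)) = 0.
Proof. by rewrite /ptrace fmap0 // compr0 comp0r. Qed.

Lemma ptrace_sum Y Z I (r : seq I) (P : pred I) (h : I -> hom (F Y) (F Z)) :
  ptrace p (\sum_(i <- r | P i) h i) = \sum_(i <- r | P i) ptrace p (h i).
Proof. by elim/big_rec2: _ => [|i y z _ <-]; rewrite ?ptrace0 ?ptraceD. Qed.

Lemma bendrZ X Z c (g : hom (F X) Z) : bendr (c *: g) = c *: bendr g.
Proof. by rewrite /bendr fmapZ // compZl. Qed.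

Lemma bendr_sum X Z I (r : seq I) (P : pred I) (g : I -> hom (F X) Z) :
  bendr (\sum_(i <- r | P i) g i) = \sum_(i <- r | P i) bendr (g i).
Proof. by rewrite /bendr fmap_sum // comp_suml. Qed.

Lemma ptrace1 d Z : is_dim p d -> ptrace p (idm (F Z)) = d *: idm Z.
Proof. by move=> pd; rewrite /ptrace fmap1 // compm1 (pd Z).2. Qed.

End Rotation.

Section FusionMatrices.
Variables (k : closedFieldType) (C : fusionCategory k).
Implicit Types X Y Z V W : C.
Local Notation I1 := (unit_obj : C).
Let ss := semisimpleP C.
Variables (n : nat) (S : 'I_n -> C).
Hypothesis tS : is_simple_transversal S.

Let sS j : is_simple (S j). Proof. by case: tS. Qed.
Let bS j : brick (S j). Proof. exact: (simple_brick ss). Qed.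

Record components Y := Components {
  csize : nat;
  cin : forall c, 'I_csize -> hom (S c) Y;
  cout : forall c, 'I_csize -> hom Y (S c);
  csum : \sum_c \sum_al (cin c al \oc cout c al) = idm Y
}.

Arguments cin {Y} _ _ _.
Arguments cout {Y} _ _ _.

Lemma components_exist Y : exists D : components Y, True.
Proof. by have [m [F [G FG]]] := decomposition ss tS Y; exists (Components FG). Qed.

Lemma expand_in Y (D : components Y) c (f : hom (S c) Y) :
  f = \sum_al coef (cout D c al \oc f) *: cin D c al.
Proof.
rewrite -[LHS]comp1m -(csum D) comp_suml (bigD1 c) //= [X in _ + X]big1 ?addr0.
  rewrite comp_suml; apply: eq_bigr => al _.
  by rewrite -compA -[X in _ \oc X](coefE _ (bS c)) compZr compm1.
move=> c' c'c; rewrite comp_suml big1 // => al _.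
by rewrite -compA [X in _ \oc X](simple_hom0 ss tS) ?compr0 // eq_sym.
Qed.

Lemma expand_out Y (D : components Y) c (g : hom Y (S c)) :
  g = \sum_al coef (g \oc cin D c al) *: cout D c al.
Proof.
rewrite -[LHS]compm1 -(csum D) comp_sumr (bigD1 c) //= [X in _ + X]big1 ?addr0.
  rewrite comp_sumr; apply: eq_bigr => al _.
  by rewrite compA -[X in X \oc _](coefE _ (bS c)) compZl comp1m.
move=> c' c'c; rewrite comp_sumr big1 // => al _.
by rewrite compA [X in X \oc _](simple_hom0 ss tS) ?comp0r.
Qed.

Variables (d : 'I_n -> k) (p : forall i, ambi (ltens (S i)) (ltens (dual (S i)))).
Hypotheses (pd : forall i, is_dim (p i) (d i)) (d0 : forall i, d i != 0).

Section Form.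
Variables a b c : 'I_n.

(** The partial trace form on Hom(c, a (x) b) x Hom(a (x) b, c); its comparison
    with the composition pairing is the twist, by [form_twist]. *)
Definition form (f : hom (S c) (S a \ox S b)) (g : hom (S a \ox S b) (S c)) : k :=
  d b / d c * coef (ptrace (p a) (f \oc g) : hom (S b) (S b)).

Lemma form_twist f : exists f2, forall g,
  form f g = coef (g \oc f2) /\ form f2 g = coef (g \oc f).
Proof.
have [LA LB LC] := And3 (lawful_tens (dual (S a))) (lawful_tens (dual (S b)))
  (lawful_tens (dual (S c))).
have [f2 f2P] := pivotal_exchange LA LB LC (pd a) (pd b) (pd c) (unit_brick C)
  (bS a) (bS b) (bS c) f.
exists f2 => g; have [e1 e2] := f2P g; rewrite /form.
by split; rewrite mulrAC -?e1 -?e2 mulrAC mulfV // mul1r.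
Qed.

Definition ftwist f := projT1 (cid (form_twist f)).

Lemma formE f g : form f g = coef (g \oc ftwist f).
Proof. by rewrite /ftwist; case: (cid _) => f2 /= /(_ g) []. Qed.

Lemma form_ftwist f g : form (ftwist f) g = coef (g \oc f).
Proof. by rewrite /ftwist; case: (cid _) => f2 /= /(_ g) []. Qed.

Lemma form_suml I (r : seq I) (P : pred I) (x : I -> k) f g :
  form (\sum_(i <- r | P i) x i *: f i) g
    = \sum_(i <- r | P i) x i * form (f i) g.
Proof.
rewrite /form comp_suml ptrace_sum; last exact: lawful_tens.
rewrite coef_sum mulr_sumr; apply: eq_bigr => i _.
rewrite compZl ptraceZ; last exact: lawful_tens.
by rewrite coefZ mulrCA.
Qed.

Variable D : components (S a \ox S b).

(** The matrix of the twist of Hom(c, a (x) b).  The vectors [cin] D c span this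
    space but need not be a basis, as some may vanish; so [gram] is idempotent
    rather than the identity, and the involutivity of the twist becomes
    theta^3 = theta. *)
Definition theta : 'M[k]_(csize D) :=
  \matrix_(al, be) form (cin D c be) (cout D c al).

Definition gram : 'M[k]_(csize D) :=
  \matrix_(al, be) coef (cout D c al \oc cin D c be).

Lemma theta_gram : theta *m gram = theta.
Proof.
apply/matrixP => al be; rewrite !mxE [in RHS](expand_in D (cin D c be)).
by rewrite form_suml; apply: eq_bigr => ga _; rewrite !mxE mulrC.
Qed.

Lemma theta_sqr : theta *m theta = gram.
Proof.
apply/matrixP => al be; rewrite !mxE -form_ftwist.
rewrite [in RHS](expand_in D (ftwist (cin D c be))) form_suml.
by apply: eq_bigr => ga _; rewrite !mxE -formE mulrC.
Qed.

Lemma theta_cube : theta *m theta *m theta = theta.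
Proof. by rewrite -mulmxA theta_sqr theta_gram. Qed.

Lemma trace_theta : \tr theta = \sum_al form (cin D c al) (cout D c al).
Proof. by apply: eq_bigr => al _; rewrite mxE. Qed.

End Form.

Variable D : forall a b, components (S a \ox S b).

(** The left partial trace of the identity of a (x) b, written as a sum over its
    simple summands. *)
Lemma sum_theta_last a b :
  \sum_c \tr (theta c (D a b)) * d c = d a * d b.
Proof.
have LD := lawful_tens (dual (S a)).
have : coef (ptrace (p a) (idm (ltens (S a) (S b)))) = d a.
  by rewrite (ptrace1 LD _ (pd a)) coef_id.
move <-; rewrite -[X in ptrace _ X](csum (D a b)) ptrace_sum // coef_sum mulr_suml.
apply: eq_bigr => c _; rewrite trace_theta ptrace_sum // coef_sum !mulr_suml.
apply: eq_bigr => al _; rewrite /form mulrC mulrA.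
by rewrite mulrCA mulfV // mulr1 mulrC.
Qed.

(** Bending a to the other side turns Hom(a (x) b, c) into Hom(b, a^* (x) c) and
    Hom(c, a (x) b) into Hom(a^* (x) c, b), and the composition pairing of the
    latter two into the partial trace.  As this differs from the composition
    pairing of the former two by an involution, bending dual families and
    twisting one of them gives dual families up to the factor d b / d c.  The
    identity of a^* (x) c expands accordingly, and its partial trace, which
    closes a^*, is the asserted sum. *)
Lemma sum_theta_middle a c :
  \sum_b \tr (theta c (D a b)) * d b = d a * d c.
Proof.
have La := lawful_tens (S a); have LD := lawful_tens (dual (S a)).
pose Y : C := ltens (dual (S a)) (S c).
pose e : hom Y Y :=
  \sum_b \sum_al (d b / d c) *: (bendr (p a) (cout (D a b) c al)
    \oc bendl (p a) (ftwist (cin (D a b) c al))).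
have e1 : e = idm Y.
  (* every x : S b -> a^* (x) S c is the bend of some g, and e fixes it by the
     expansion of g in the dual families *)
  apply: (eq_id ss tS) => b x.
  have [g ->] := bendr_surj LD (p a) x.
  rewrite /e comp_suml (bigD1 b) //= [X in _ + X]big1 ?addr0.
    rewrite [in RHS](expand_out (D a b) g) bendr_sum // comp_suml.
    apply: eq_bigr => al _; rewrite bendrZ // compZl.
    rewrite -[X in _ *: X]compA (bendl_bendr LD (p a)) //.
    rewrite -[X in _ \oc X](coefE _ (bS b)) compZr compm1 scalerA.
    by rewrite -form_ftwist.
  move=> b' b'b; rewrite comp_suml big1 // => al _.
  rewrite compZl -[X in _ *: X]compA (bendl_bendr LD (p a)) //.
  by rewrite [ptrace _ _](simple_hom0 ss tS) ?compr0 ?scaler0 // eq_sym.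
have sd : is_dim (ambi_swap (p a)) (d a) by move=> Z; case: (pd a Z).
have := congr1 (@coef _ _ _) (ptrace1 La (S c) sd).
rewrite coef_id // -[X in ptrace _ X]e1 /e ptrace_sum // coef_sum => <-.
rewrite mulr_suml; apply: eq_bigr => b _.
rewrite trace_theta ptrace_sum // coef_sum !mulr_suml; apply: eq_bigr => al _.
rewrite ptraceZ // (ptrace_swap La (p a)) coefZ -formE.
by rewrite [RHS]mulrAC divfK // mulrC.
Qed.

(** If a is isomorphic to the unit then a (x) b is isomorphic to b. *)
Lemma theta_unit a b c : isomorphic (S a) I1 -> b != c ->
  \tr (theta c (D a b)) = 0.
Proof.
move=> [u [v uv]] bc; rewrite trace_theta big1 // => al _.
have iso := tensm_inverse uv (is_inverse1 (S b)).
suff -> : cin (D a b) c al = 0.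
  by rewrite /form comp0r ptrace0 ?coef0 ?mulr0 //; exact: lawful_tens.
apply: (iso_cancell iso); apply: (iso_cancell (lunitK (S b))).
by rewrite !compr0; apply: (simple_hom0 ss tS); rewrite eq_sym.
Qed.

End FusionMatrices.

Theorem fusion_matrices (k : closedFieldType) (C : fusionCategory k) n
    (S : 'I_n -> C) : is_simple_transversal S ->
  exists (d : 'I_n -> k) (T : 'I_n -> 'I_n -> 'I_n -> k),
    [/\ forall i, d i ^+ 2 = sqnorm (S i) /\ d i != 0,
        forall i j, \sum_c T i j c * d c = d i * d j,
        forall i c, \sum_j T i j c * d j = d i * d c,
        forall i j c, exists m (Q : 'M[k]_m),
          Q *m Q *m Q = Q /\ T i j c = \tr Q
      & forall i j c, isomorphic (S i) unit_obj -> j != c -> T i j c = 0].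
Proof.
move=> tS; have [sS _ _] := tS.
have pP i : {d : k & {p : ambi (ltens (S i)) (ltens (dual (S i))) |
    [/\ is_dim p d, d ^+ 2 = sqnorm (S i) & d != 0]}}.
  have [d /cid p] := cid (normalized_pivot (sS i)).
  by exists d.
pose d i := projT1 (pP i); pose p i := projT1 (projT2 (pP i)).
have pd i : is_dim (p i) (d i) by case: (projT2 (projT2 (pP i))).
have d0 i : d i != 0 by case: (projT2 (projT2 (pP i))).
pose D a b : components S (S a \ox S b) :=
  projT1 (cid (components_exist tS (S a \ox S b))).
exists d, (fun a b c => \tr (theta d p c (D a b))); split.
- by move=> i; split=> //; case: (projT2 (projT2 (pP i))).
- by move=> a b; exact: sum_theta_last.
- by move=> a c; exact: sum_theta_middle.
- move=> a b c; exists _, (theta d p c (D a b)); split=> //.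
  exact: theta_cube.
by move=> a b c u bc; exact: theta_unit.
Qed.

(** * Integrality of the traces *)

Import Order.TTheory Num.Theory.

Section IntegralTrace.
Variables (k : fieldType).
Hypothesis hchar : [pchar k] =i pred0.

Lemma intr_eq0_char0 (z : int) : z%:~R = 0 :> k -> z = 0.
Proof.
case: z => m e; apply/eqP.
  by move: e; rewrite -pmulrn => /eqP; rewrite (pcharf0P _).1.
by move: e; rewrite NegzE mulrNz => /eqP; rewrite oppr_eq0 -pmulrn (pcharf0P _).1.
Qed.

(** In a full rank factorisation P = col R one has R col = 1. *)
Lemma trace_idempotent n (P : 'M[k]_n) : P *m P = P -> \tr P = (\rank P)%:R.
Proof.
move=> PP; have E := mulmx_base P.
have RC : row_base P *m col_base P = 1%:M.
  apply: (row_full_inj (col_base_full P)).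
  apply: (row_free_inj (row_base_free P)).
  by rewrite mulmx1 E -[in RHS]PP -[in RHS]E !mulmxA.
by rewrite -{1}E mxtrace_mulC RC mxtrace1.
Qed.

(** Q is the difference of the idempotents (Q^2 + Q) / 2 and (Q^2 - Q) / 2. *)
Lemma trace_tripotent n (Q : 'M[k]_n) : Q *m Q *m Q = Q ->
  exists z : int, \tr Q = z%:~R.
Proof.
move=> QQQ.
have two0 : 2%:R != 0 :> k by rewrite (pcharf0P _).1.
have QQ : Q *m (Q *m Q) = Q by rewrite mulmxA.
pose P1 := 2%:R^-1 *: (Q *m Q + Q); pose P2 := 2%:R^-1 *: (Q *m Q - Q).
have half2 (x : 'M[k]_n) : 2%:R^-1 *: (x + x) = x.
  by rewrite -mulr2n -scaler_nat scalerA mulVf // scale1r.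
have QQ2 : Q *m Q *m (Q *m Q) = Q *m Q by rewrite mulmxA QQQ.
have P11 : P1 *m P1 = P1.
  rewrite /P1 -scalemxAl -scalemxAr mulmxDl !mulmxDr QQQ QQ QQ2.
  by rewrite [Q + _]addrC half2.
have P22 : P2 *m P2 = P2.
  rewrite /P2 -scalemxAl -scalemxAr mulmxBl !mulmxBr QQQ QQ QQ2.
  by rewrite opprB half2.
have QE : Q = P1 - P2.
  by rewrite /P1 /P2 -scalerBr opprB addrC addrA subrK half2.
exists ((\rank P1)%:Z - (\rank P2)%:Z).
by rewrite {1}QE raddfB /= !trace_idempotent // intrB.
Qed.

End IntegralTrace.

(** For i isomorphic to the unit T i is diagonal, and its eigenvector d has no
    zero entry: all the diagonal entries are equal to d i. *)
Lemma integral_fusion_matrices (k : closedFieldType) (C : fusionCategory k) n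
    (S : 'I_n -> C) : [pchar k] =i pred0 -> is_simple_transversal S ->
  exists (d : 'I_n -> k) (T : 'I_n -> 'I_n -> 'I_n -> int),
    [/\ forall i, d i ^+ 2 = sqnorm (S i) /\ d i != 0,
        forall i j, \sum_c (T i j c)%:~R * d c = d i * d j,
        forall i c, \sum_j (T i j c)%:~R * d j = d i * d c
      & exists i (t : int), d i = t%:~R /\
          forall j c, T i j c = if j == c then t else 0].
Proof.
move=> hchar tS; have [d [T [dS dr dm TQ Tu]]] := fusion_matrices tS.
have TP i j c : {z : int | T i j c = z%:~R}.
  apply: cid; have [m [Q [QQQ ->]]] := TQ i j c.
  exact: trace_tripotent.
have [_ cover _] := tS.
have [i iu] := cover _ (unit_simple C).
have ui : isomorphic (S i) unit_obj.
  by have [f [g fg]] := iu; exists g, f; exact: is_inverse_sym.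
pose Z a b c := projT1 (TP a b c).
have ZE a b c : (Z a b c)%:~R = T a b c by rewrite (projT2 (TP a b c)).
have diag j : T i j j = d i.
  have := dr i j; rewrite (bigD1 j) //= big1 ?addr0 => [e|c cj].
    by apply: (mulIf (dS j).2).
  by rewrite Tu ?mul0r // eq_sym.
exists d, Z; split=> //.
- by move=> a b; rewrite -dr; apply: eq_bigr => c _; rewrite ZE.
- by move=> a c; rewrite -dm; apply: eq_bigr => b _; rewrite ZE.
exists i, (Z i i i); split=> // [|j c]; first by rewrite ZE diag.
apply/eqP; rewrite -subr_eq0; apply/eqP/(intr_eq0_char0 hchar); rewrite intrB.
case: eqP => [<-|/eqP jc]; first by rewrite !ZE !diag subrr.
by rewrite ZE Tu // subr0.
Qed.

(** * Positivity and nonvanishing of the global dimension *)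

Section Transversals.
Variables (k : fieldType) (C : linCategory k).
Implicit Types X Y Z V : C.

Lemma isomorphic_refl X : isomorphic X X.
Proof. by exists (idm X), (idm X); split; rewrite comp1m. Qed.

Lemma isomorphic_sym X Y : isomorphic X Y -> isomorphic Y X.
Proof. by move=> [f [g fg]]; exists g, f; exact: is_inverse_sym. Qed.

Lemma isomorphic_trans X Y Z :
  isomorphic X Y -> isomorphic Y Z -> isomorphic X Z.
Proof.
move=> [f [f' [ff' f'f]]] [g [g' [gg' g'g]]].
exists (comp g f), (comp f' g'); split.
  by rewrite -compA (compA g') gg' comp1m.
by rewrite -compA (compA f) f'f comp1m.
Qed.

(** The squared norm of V itself, rather than of an isomorphic representative, is
    covered by choosing V as a representative. *)
Lemma transversal_through n (S : 'I_n -> C) V :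
  is_simple_transversal S -> is_simple V ->
  exists (S' : 'I_n -> C) j, is_simple_transversal S' /\ S' j = V.
Proof.
move=> [sS cover inj] sV; have [j Vj] := cover V sV.
pose S' l := if l == j then V else S l.
have S'S l : isomorphic (S' l) (S l).
  by rewrite /S'; case: eqP => [->|_] //; exact: isomorphic_refl.
exists S', j; split; last by rewrite /S' eqxx.
split=> [l|W sW|l m lm].
- by rewrite /S'; case: ifP.
- have [l Wl] := cover W sW; exists l.
  exact: isomorphic_trans Wl (isomorphic_sym (S'S l)).
- apply: inj; apply: isomorphic_trans (isomorphic_sym (S'S l)) _.
  exact: isomorphic_trans lm (S'S m).
Qed.

End Transversals.

Section IntegerMatrices.

(** A left null vector v satisfies sum_j |T_j v|^2 = 0, in particular t v = 0. *)
Lemma gram_det_neq0 n (T : 'I_n -> 'M[int]_n) i (t : int) :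
  t != 0 -> T i = t%:M -> \det (\sum_j (T j)^T *m T j) != 0.
Proof.
move=> t0 Ti; apply/det0P => -[v v0 vN].
pose w j := T j *m v^T.
have norm_ge0 j : 0 <= ((w j)^T *m w j) 0 0.
  by rewrite mxE sumr_ge0 // => l _; rewrite !mxE -expr2 sqr_ge0.
have : (v *m (\sum_j (T j)^T *m T j) *m v^T) 0 0 = 0 by rewrite vN mul0mx mxE.
rewrite mulmx_sumr mulmx_suml summxE.
have E j : v *m ((T j)^T *m T j) *m v^T = (w j)^T *m w j.
  by rewrite /w trmx_mul trmxK !mulmxA.
under eq_bigr do rewrite E.
move/psumr_eq0P => /(_ (fun j _ => norm_ge0 j) i isT) => wi0.
case/eqP: v0; apply/rowP => l; rewrite mxE.
move: wi0; rewrite mxE => /psumr_eq0P wl0.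
have /eqP : (w i)^T 0 l * w i l 0 = 0.
  by apply: wl0 => // m _; rewrite mxE -expr2 sqr_ge0.
rewrite mxE mulf_eq0 orbb /w Ti mul_scalar_mx !mxE mulf_eq0 (negPf t0).
by move/eqP.
Qed.

End IntegerMatrices.

Lemma global_dim_neq0 (k : closedFieldType) (hchar : [pchar k] =i pred0)
  (C : fusionCategory k) : global_dim C != 0.
Proof.
have tS := projT2 (cid (finite_simples C)).
rewrite /global_dim -/(simples C) in tS *.
case: (simples C) tS => n S /= tS.
have [d [T [dS dr dm [i [t [dit Tt]]]]]] := integral_fusion_matrices hchar tS.
have d0 j : d j != 0 by case: (dS j).
pose A j : 'M[int]_n := \matrix_(l, c) T j l c.
pose N := \sum_j (A j)^T *m A j.
have t0 : t != 0 by apply: contraNneq (d0 i) => t0; rewrite dit t0.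
have Ai : A i = t%:M by apply/matrixP => l c; rewrite !mxE Tt; case: eqP.
have detN : \det N != 0 := gram_det_neq0 t0 Ai.
have detNk : \det (map_mx intr N : 'M[k]_n) != 0.
  by rewrite det_map_mx; apply: contra_neq detN => /(intr_eq0_char0 hchar).
pose v : 'rV[k]_n := \row_l d l.
apply: contraNneq detNk => dim0; apply/det0P; exists v.
  by apply/eqP => /rowP/(_ i)/eqP; rewrite !mxE (negPf (d0 i)).
have vA j : v *m map_mx intr (A j) = d j *: v.
  apply/rowP => c; rewrite !mxE -dm; apply: eq_bigr => l _.
  by rewrite !mxE mulrC.
have vAT j : v *m (map_mx intr (A j))^T = d j *: v.
  apply/rowP => l; rewrite !mxE -dr; apply: eq_bigr => c _.
  by rewrite !mxE mulrC.
rewrite /N map_mx_sum mulmx_sumr.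
under eq_bigr => j _ do
  rewrite map_mxM -map_trmx mulmxA vAT -scalemxAl vA scalerA -expr2 (dS j).1.
by rewrite -scaler_suml dim0 scale0r.
Qed.

Section Positivity.
Variables (K : numClosedFieldType) (C : fusionCategory K).

Section Transversal.
Variables (n : nat) (S : 'I_n -> C).
Hypothesis tS : is_simple_transversal S.

(** Put v = T_j d = d_j d.  The squared length of v is |d_j|^2 |d|^2; but moving
    the real matrix T_j to the other side of the inner product makes it
    <d_j d, T_j d> = <d_j T_j^T d, d> = d_j^2 |d|^2. *)
Lemma sqnorm_transversal_gt0 j : 0 < sqnorm (S j).
Proof.
have [d [T [dS dr dm _]]] := integral_fusion_matrices (@pchar_num K) tS.
have d0 l : d l != 0 by case: (dS l).
rewrite -(dS j).1.
pose s := \sum_l `|d l| ^+ 2.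
have s_gt0 : 0 < s.
  rewrite /s (bigD1 j) //= ltr_wpDr ?sumr_ge0 // => [l _|].
    by rewrite exprn_ge0.
  by rewrite exprn_gt0 // normr_gt0.
suff e : d j ^+ 2 * s = `|d j| ^+ 2 * s.
  by rewrite (mulIf (lt0r_neq0 s_gt0) e) exprn_gt0 // normr_gt0.
transitivity (\sum_l (d j * d l) * (d j * d l)^*); last first.
  rewrite mulr_sumr; apply: eq_bigr => l _.
  by rewrite -normCK normrM exprMn.
transitivity (\sum_l \sum_c (d j * d l) * ((T j l c)%:~R * (d c)^*)).
  rewrite exchange_big mulr_sumr /=; apply: eq_bigr => c _.
  rewrite normCK mulrA expr2 -(mulrA (d j)) -dm.
  rewrite mulr_sumr mulr_suml; apply: eq_bigr => l _.
  by rewrite [_%:~R * d l]mulrC !mulrA.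
apply: eq_bigr => l _; rewrite -mulr_sumr -dr rmorph_sum.
by congr (_ * _); apply: eq_bigr => c _; rewrite rmorphM /= rmorph_int.
Qed.

(** The dimension of the representative of the unit is a nonzero integer. *)
Lemma some_sqnorm_ge1 : exists i, 1 <= sqnorm (S i).
Proof.
have [d [T [dS _ _ [i [t [dit _]]]]]] :=
  integral_fusion_matrices (@pchar_num K) tS.
exists i; have [<- d0] := dS i.
have t0 : t != 0 by apply: contraNneq d0 => t0; rewrite dit t0.
rewrite dit -rmorphXn /= -[1]/(1%:~R) ler_int.
by rewrite -gtz0_ge1 exprn_even_gt0.
Qed.

End Transversal.

Lemma simples_transversal : is_simple_transversal (tagged (simples C)).
Proof. exact: projT2 (cid (finite_simples C)). Qed.

Lemma sqnorm_gt0 (V : C) : is_simple V -> 0 < sqnorm V.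
Proof.
move=> sV; have [S [j [tS <-]]] := transversal_through simples_transversal sV.
exact: sqnorm_transversal_gt0.
Qed.

Lemma global_dim_ge1 : 1 <= global_dim C.
Proof.
have tS := simples_transversal; have [i i1] := some_sqnorm_ge1 tS.
rewrite /global_dim (bigD1 i) //= ler_wpDr // sumr_ge0 // => l _.
exact/ltW/sqnorm_transversal_gt0.
Qed.

Lemma global_dim_gt1 : is_nontrivial C -> 1 < global_dim C.
Proof.
have tS := simples_transversal; have [i i1] := some_sqnorm_ge1 tS.
have pos l : 0 < sqnorm (tagged (simples C) l) by exact: sqnorm_transversal_gt0.
have [_ cover _] := tS; move=> [V [W [sV sW VW]]].
have [l li] : exists l, l != i.
  have [a Va] := cover V sV; have [b Wb] := cover W sW.
  case: (eqVneq a i) => [ai|]; last by exists a.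
  case: (eqVneq b i) => [bi|]; last by exists b.
  case: VW; apply: isomorphic_trans Va _; rewrite ai -bi.
  exact: isomorphic_sym.
rewrite /global_dim (bigD1 i) //= (bigD1 l) //=.
rewrite -[1]addr0 ler_ltD // ltr_wpDr // sumr_ge0 // => m _.
exact: ltW.
Qed.

End Positivity.

Theorem theorem2p3 :
  (forall (R : realType) (C : fusionCategory R[i]),
     [/\ forall V : C, is_simple V -> 0 < sqnorm V,
         1 <= global_dim C
       & is_nontrivial C -> 1 < global_dim C])
  /\
  (forall (k : closedFieldType) (hchar : [pchar k] =i pred0)
          (C : fusionCategory k),
     global_dim C <> 0).
Proof.
split=> [R C|k hchar C]; last exact/eqP/global_dim_neq0.
split; [exact: sqnorm_gt0|exact: global_dim_ge1|exact: global_dim_gt1].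
Qed.
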